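(* Let $p>2$. For every finite interval $Q$ and every $\varphi\in\mathrm{BMO}(Q)$, $$\inf_{f\in L^\infty(Q)}\|\varphi-f\|_{\mathrm{BMO}^p(Q)}\ \ge\ \frac{\varepsilon_0(p)}{\min\{\varepsilon_\varphi,\varepsilon_{-\varphi}\}},$$ and this inequality is sharp, in the sense that the constant $\varepsilon_0(p)$ on the right-hand side cannot be replaced by any larger constant.
   Context: For a finite interval $J$ and $\varphi\in L^1(J)$ (real-valued), $\langle\varphi\rangle_J=\frac1{|J|}\int_J\varphi$. For a finite interval $Q$ and $p>0$, $$\|\varphi\|_{\mathrm{BMO}^p(Q)}=\sup_{\text{intervals }J\subset Q}\big\langle|\varphi-\langle\varphi\rangle_J|^p\big\rangle_J^{1/p},$$ and $\mathrm{BMO}(Q)=\{\varphi\in L^1(Q):\|\varphi\|_{\mathrm{BMO}^p(Q)}<\infty\}$ (this set does not depend on $p$). A weight (an almost everywhere positive function) $w$ on $Q$ belongs to $A_\infty(Q)$ if $w$ and $\log w$ are integrable on $Q$ and $[w]_{A_\infty(Q)}:=\sup_{\text{intervals }J\subset Q}\langle w\rangle_J e^{-\langle\log w\rangle_J}<\infty$. For $\varphi\in\mathrm{BMO}(Q)$, $$\varepsilon_\varphi=\sup\{\varepsilon:\ e^{\varepsilon\varphi}\in A_\infty(Q)\}\in(0,\infty].$$ If $\min\{\varepsilon_\varphi,\varepsilon_{-\varphi}\}=\infty$, the right-hand side of the inequality is read as $0$. The John--Nirenberg constant $\varepsilon_0(p)$ is the largest possible number with the following property: for every $\varepsilon\in[0,\varepsilon_0(p))$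 there is $C(\varepsilon,p)>0$ such that for every finite interval $Q$, every $\varphi\in\mathrm{BMO}(Q)$ with $\|\varphi\|_{\mathrm{BMO}^p(Q)}\le\varepsilon$, and every interval $J\subset Q$, $\langle e^{\varphi}\rangle_J\le C(\varepsilon,p)\,e^{\langle\varphi\rangle_J}$. *)

(* Defs.v *)
From HB Require Import structures.
From mathcomp Require Import all_boot all_order all_algebra.
From mathcomp Require Import all_classical all_reals all_analysis.

Set Implicit Arguments.
Unset Strict Implicit.
Unset Printing Implicit Defensive.

Import Order.TTheory GRing.Theory Num.Theory.
Import numFieldNormedType.Exports.

Local Open Scope classical_set_scope.
Local Open Scope ring_scope.
Local Open Scope ereal_scope.

Section bmo.
Context {R : realType}.
Local Notation mu := (@lebesgue_measure R).
Implicit Types (J Q : set R) (phi w : R -> R) (p : R).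

(* Nondegenerate bounded intervals, with or without their endpoints. *)
Definition finite_interval J := is_interval J /\ 0 < mu J < +oo.

Definition subinterval Q J := finite_interval J /\ J `<=` Q.

(* [eavg] takes the value +oo on nonnegative functions that are not
   integrable; [avg] is meaningful for integrable functions only. *)
Definition eavg J phi : \bar R := (mu J)^-1 * \int[mu]_(x in J) (phi x)%:E.

Definition avg J phi : R := fine (eavg J phi).

Definition bmo_norm p Q phi : \bar R :=
  ereal_sup [set (eavg J (fun x => `|phi x - avg J phi|%R `^ p)%R) `^ p^-1
            | J in subinterval Q].

Definition BMO p Q phi :=
  mu.-integrable Q (EFin \o phi) /\ bmo_norm p Q phi < +oo.

(* Elements of L^oo(Q) are total functions whose values off Q are irrelevant. *)
Definition Linfty Q phi := phi \_ Q \in Lfun mu +oo.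

Definition bmo_dist p Q phi : \bar R :=
  ereal_inf [set bmo_norm p Q (phi \- f)%R | f in Linfty Q].

Definition Ainfty_const Q w : \bar R :=
  ereal_sup [set eavg J w * (expR (- avg J (@ln R \o w)))%:E
            | J in subinterval Q].

Definition Ainfty Q w :=
  [/\ {ae mu, forall x, Q x -> (0 < w x)%R},
      mu.-integrable Q (EFin \o w),
      mu.-integrable Q (EFin \o (@ln R \o w)) &
      Ainfty_const Q w < +oo].

(* The number epsilon_phi. *)
Definition Ainfty_index Q phi : \bar R :=
  ereal_sup [set e%:E | e in [set e : R | Ainfty Q (fun x => expR (e * phi x))]].

Definition JN_property p (e0 : R) :=
  forall e : R, (0 <= e < e0)%R ->
  exists2 C : R, (0 < C)%R &
    forall Q phi, finite_interval Q -> BMO p Q phi -> bmo_norm p Q phi <= e%:E ->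
    forall J, subinterval Q J ->
      eavg J (@expR R \o phi) <= (C * expR (avg J phi))%:E.

(* [JN_property p] is preserved by suprema, so this is the largest number
   that has it. *)
Definition JN_const p : \bar R :=
  ereal_sup [set e0%:E | e0 in [set e0 : R | JN_property p e0]].

(* For extended reals, +oo^-1 = 0 and c * 0 = 0, so that the value is 0 when
   the minimum is +oo. *)
Definition JN_bound (c : \bar R) Q phi : \bar R :=
  c / Order.min (Ainfty_index Q phi) (Ainfty_index Q (\- phi)%R).

End bmo.

(* Main.v *)
Require Import Defs.
From mathcomp Require Import all_boot all_order all_algebra.
From mathcomp Require Import all_classical all_reals all_analysis.
From mathcomp Require Import measurable_realfun ess_sup_inf.
From mathcomp Require Import ring lra zify.

(* If [JN_property p e0] holds and [f] is bounded, then [e^{k phi}] differs from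
   [e^{k (phi - f)}] by a bounded factor, so it is in [A_oo] as soon as
   [|k| * ||phi - f|| < e0]; this gives the inequality.

   For sharpness, [-ln] on ]0, 1[ is extremal: its index is 1, and its BMO^p norm
   is at most the John-Nirenberg constant.  For the latter, let [phi] have norm
   at most [e] on an interval.  By the rising sun lemma every superlevel set [D]
   satisfies [int_D |phi - <phi>_D|^p <= e^p |D|].  Take nested superlevel sets of
   measures [rho^j]; let [a_j] be the average of [phi] on the j-th difference.
   Averaging these oscillation bounds over the first [K] scales, Jensen's
   inequality bounds by [e^p] the oscillation, for geometric weights, of a
   sequence whose increments are at least [l = (a_K - a_I) / K].  A sequence
   oscillates more than another one if the difference is also nondecreasing, so
   [l N <= e], where [N] is the oscillation of [i |-> i].  Hence [a_K] grows at
   rate at most [e / N], and [e^phi] is integrable with a uniform bound as soon as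
   [e < (-ln rho) N].  So every [(-ln rho) N] is at most the John-Nirenberg
   constant, while the oscillation of [-ln] on an interval ]a, b[ is the limit of
   that of step functions whose increments are at most [-ln rho], so that it is
   bounded by the same numbers. *)

Set Implicit Arguments.
Unset Strict Implicit.
Unset Printing Implicit Defensive.

Import Order.TTheory GRing.Theory Num.Theory.
Import numFieldNormedType.Exports.

Local Open Scope classical_set_scope.
Local Open Scope ring_scope.

(** * Oscillations of finite weighted sequences *)

Section finite_sums.
Context {R : realType}.
Variable p : R.
Hypothesis p_gt1 : 1 < p.

(* [p * spow] is the derivative of [fun y => `|y| `^ p]. *)
Definition spow (y : R) : R := Num.sg y * `|y| `^ (p - 1).

Let p_gt0 : 0 < p. Proof. exact: lt_trans p_gt1. Qed.
Let pB1_gt0 : 0 < p - 1. Proof. by rewrite subr_gt0. Qed.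

(** Young's inequality for x and y^(p-1): the exponent conjugate to p is p / (p - 1), which turns
    the second factor into y^p. *)
Lemma young_powR (x y : R) : 0 <= x -> 0 <= y ->
  p * (x * y `^ (p - 1)) <= x `^ p + (p - 1) * y `^ p.
Proof.
move=> x0 y0.
have := @conjugate_powR R x (y `^ (p - 1)) p (p / (p - 1)) x0 (powR_ge0 _ _)
  p_gt0 (divr_gt0 p_gt0 pB1_gt0).
have -> : p^-1 + (p / (p - 1))^-1 = 1.
  by field; rewrite !gt_eqF.
move=> /(_ erefl).
have pp : (p - 1) * (p / (p - 1)) = p by field; rewrite gt_eqF.
rewrite -powRrM pp => /(ler_wpM2l (ltW p_gt0)) /le_trans; apply.
rewrite le_eqVlt; apply/orP; left; apply/eqP.
by field; rewrite !gt_eqF.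
Qed.

(** The graph of |y|^p lies above its tangents. As [spow y * y] is |y|^p, this reduces to Young's
    inequality for |x| and |y|. Both Jensen inequalities, the comparison of oscillations and the
    continuity of the power rest on it. *)
Lemma powR_tangent (x y : R) :
  `|y| `^ p + p * spow y * (x - y) <= `|x| `^ p.
Proof.
have h : spow y * y = `|y| `^ p.
  by rewrite /spow mulrAC -normrEsg mulr_powRB1.
rewrite mulrBr -[p * spow y * y]mulrA h.
have h1 : spow y * x <= `|x| * `|y| `^ (p - 1).
  apply: (le_trans (ler_norm _)).
  rewrite /spow !normrM mulrC ler_wpM2l//.
  rewrite normr_sg ger0_norm ?powR_ge0// ler_piMl ?powR_ge0//.
  by case: (y != 0).
have := young_powR (normr_ge0 x) (normr_ge0 y).
have : p * spow y * x <= p * (`|x| * `|y| `^ (p - 1)).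
  by rewrite -mulrA ler_wpM2l// ltW.
lra.
Qed.

Lemma spow_homo (x y : R) : x <= y -> spow x <= spow y.
Proof.
move=> xy; rewrite /spow.
have pw (a b : R) : 0 <= a -> a <= b -> a `^ (p - 1) <= b `^ (p - 1).
  move=> a0 ab; apply: ge0_ler_powR => //; first exact: ltW.
  by rewrite nnegrE (le_trans a0).
case: (ltgtP x 0) => [x0|x0|]; last first.
- move=> x0; rewrite x0 sgr0 mul0r mulr_ge0 ?powR_ge0// sgr_ge0 -x0//.
- rewrite !gtr0_sg ?(lt_le_trans x0)// !mul1r; apply: pw => //.
  by rewrite !gtr0_norm ?(lt_le_trans x0).
- rewrite (ltr0_sg x0); case: (ltP y 0) => y0; last first.
    apply: (@le_trans _ _ 0); first by rewrite mulN1r oppr_le0 powR_ge0.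
    by rewrite mulr_ge0 ?powR_ge0// sgr_ge0.
  rewrite (ltr0_sg y0) !mulN1r lerN2; apply: pw => //.
  by rewrite !ltr0_norm// lerN2.
Qed.

Definition weighted_mean n (w x : nat -> R) := \sum_(i < n) w i * x i.
Definition weighted_osc n (w x : nat -> R) :=
  \sum_(i < n) w i * `|x i - weighted_mean n w x| `^ p.

(** Chebyshev's sum inequality: twice the sum is the double sum of w_i w_k (f_i - f_k) (g_i - g_k),
    whose terms are nonnegative. *)
Lemma chebyshev_sum n (w f g : nat -> R) :
  (forall i, 0 <= w i) -> \sum_(i < n) w i = 1 ->
  (forall i j, (i <= j < n)%N -> f i <= f j) ->
  (forall i j, (i <= j < n)%N -> g i <= g j) ->
  0 <= \sum_(i < n) w i * (f i * (g i - weighted_mean n w g)).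
Proof.
move=> w0 w1 f_nd g_nd.
set S := \sum_(i < n) _.
have -> : S = \sum_(i < n) \sum_(k < n) w i * w k * (f i * (g i - g k)).
  apply: eq_bigr => i _.
  rewrite /weighted_mean -[g i in LHS]mul1r -[in LHS]w1 mulr_suml -sumrB !mulr_sumr.
  by apply: eq_bigr => k _; ring.
have h : \sum_(i < n) \sum_(k < n) w i * w k * (f i * (g i - g k)) =
    \sum_(i < n) \sum_(k < n) w i * w k * (f k * (g k - g i)).
  by rewrite exchange_big/=; apply: eq_bigr => i _; apply: eq_bigr => k _; ring.
have : 0 <= \sum_(i < n) \sum_(k < n) w i * w k * ((f i - f k) * (g i - g k)).
  apply: sumr_ge0 => i _; apply: sumr_ge0 => k _.
  apply: mulr_ge0; first exact: mulr_ge0.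
  have [ik|/ltnW ik] := leqP i k.
    have ikn : (i <= k < n)%N by rewrite ik/=.
    by rewrite mulr_le0// subr_le0 ?f_nd ?g_nd.
  have kin : (k <= i < n)%N by rewrite ik/=.
  by rewrite mulr_ge0// subr_ge0 ?f_nd ?g_nd.
have -> : \sum_(i < n) \sum_(k < n) w i * w k * ((f i - f k) * (g i - g k)) =
  \sum_(i < n) \sum_(k < n) w i * w k * (f i * (g i - g k)) +
  \sum_(i < n) \sum_(k < n) w i * w k * (f k * (g k - g i)).
  rewrite -big_split/=; apply: eq_bigr => i _.
  by rewrite -big_split/=; apply: eq_bigr => k _; ring.
rewrite -h; lra.
Qed.

(* The tangent inequality at [y] leaves a remainder that is the covariance of two
   nondecreasing sequences, which is nonnegative. *)
Lemma weighted_osc_comonotone n (w x y : nat -> R) :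
  (forall i, 0 <= w i) -> \sum_(i < n) w i = 1 ->
  (forall i j, (i <= j < n)%N -> y i <= y j) ->
  (forall i j, (i <= j < n)%N -> x i - y i <= x j - y j) ->
  weighted_osc n w y <= weighted_osc n w x.
Proof.
move=> w0 w1 y_nd xy_nd.
pose z i := x i - y i.
have zmean : weighted_mean n w z = weighted_mean n w x - weighted_mean n w y.
  by rewrite /weighted_mean -sumrB; apply: eq_bigr => i _; rewrite mulrBr.
pose f i := spow (y i - weighted_mean n w y).
have f_nd i j : (i <= j < n)%N -> f i <= f j.
  by move=> /y_nd ij; apply: spow_homo; rewrite lerD2r.
have := chebyshev_sum w0 w1 f_nd xy_nd.
move=> /(mulr_ge0 (ltW p_gt0)); rewrite mulr_sumr => h.
apply: (@le_trans _ _ (weighted_osc n w y +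
    \sum_(i < n) p * (w i * (f i * (z i - weighted_mean n w z))))).
  by rewrite lerDl.
rewrite /weighted_osc -big_split/=; apply: ler_sum => i _.
have := ler_wpM2l (w0 i)
  (powR_tangent (x i - weighted_mean n w x) (y i - weighted_mean n w y)).
rewrite zmean /f /z; apply: le_trans.
by rewrite le_eqVlt; apply/orP; left; apply/eqP; ring.
Qed.

Lemma weighted_osc_scale n (w x : nat -> R) c : 0 <= c ->
  weighted_osc n w (fun i => c * x i) = c `^ p * weighted_osc n w x.
Proof.
move=> c0; rewrite /weighted_osc mulr_sumr; apply: eq_bigr => i _.
have -> : weighted_mean n w (fun i => c * x i) = c * weighted_mean n w x.
  by rewrite /weighted_mean mulr_sumr; apply: eq_bigr => j _; rewrite mulrCA.
by rewrite -mulrBr normrM (ger0_norm c0) powRM// mulrCA.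
Qed.

(** The tangent inequalities at the mean are added up; their linear terms cancel. *)
Lemma powR_jensen K (x : nat -> R) : (0 < K)%N ->
  `|(\sum_(j < K) x j) / K%:R| `^ p <= (\sum_(j < K) `|x j| `^ p) / K%:R.
Proof.
move=> K0; have K0R : 0 < K%:R :> R by rewrite ltr0n.
rewrite ler_pdivlMr//; set y := _ / _.
have hy : \sum_(j < K) x j = K%:R * y.
  by rewrite /y mulrCA divff ?mulr1// gt_eqF.
have : \sum_(j < K) (`|y| `^ p + p * spow y * (x j - y)) <= \sum_(j < K) `|x j| `^ p.
  by apply: ler_sum => j _; exact: powR_tangent.
rewrite big_split/= sumr_const card_ord -mulr_sumr sumrB sumr_const card_ord hy.
by rewrite -[y *+ K]mulr_natl subrr mulr0 addr0 -[_ *+ K]mulr_natr.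
Qed.

End finite_sums.

(** * Growth of sequences of bounded oscillation under geometric weights *)

Section growth.
Context {R : realType}.
Variables (p rho : R) (I : nat).
Hypotheses (p_gt1 : 1 < p) (rho01 : 0 < rho < 1).

(* The geometric distribution truncated at [I]: the mass beyond [I] is put at [I]. *)
Definition geo_weight i : R := if (i < I)%N then (1 - rho) * rho ^+ i else rho ^+ I.

Definition geo_osc : R := weighted_osc p I.+1 geo_weight (fun i => i%:R).

Lemma geo_weight_ge0 i : 0 <= geo_weight i.
Proof.
by case/andP: rho01 => r0 r1; rewrite /geo_weight; case: ifP => _;
  rewrite ?mulr_ge0 ?exprn_ge0// ?ltW// subr_gt0.
Qed.

Lemma geo_weight_sum : \sum_(i < I.+1) geo_weight i = 1.
Proof.
rewrite big_ord_recr/= {2}/geo_weight ltnn.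
under eq_bigr => i _ do rewrite /geo_weight ltn_ord.
elim: I => [|n IH]; first by rewrite big_ord0 add0r expr0.
by rewrite big_ord_recr/= -[RHS]IH -addrA; congr (_ + _); rewrite exprS; ring.
Qed.

Lemma geo_osc_ge0 : 0 <= geo_osc.
Proof. by apply: sumr_ge0 => i _; rewrite mulr_ge0 ?geo_weight_ge0 ?powR_ge0. Qed.

Variables (a m : nat -> R) (e : R).
Hypotheses (e0 : 0 <= e) (a_nd : forall i, a i <= a i.+1) (am : forall i, a i <= m i).

(** In the application [a] and [m] are the averages over shells and over superlevel sets. The
    weights do not depend on the scale [j], so the sequences [v j] can be averaged over [j]. *)
Let v j i := if (i < I)%N then a (j + i)%N else m (j + I)%N.

Hypothesis v_mean : forall j, weighted_mean I.+1 geo_weight (v j) = m j.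
Hypothesis v_osc : forall j, weighted_osc p I.+1 geo_weight (v j) <= e `^ p.

Let p_gt0 : 0 < p. Proof. exact: lt_trans p_gt1. Qed.

Let a_homo i j : (i <= j)%N -> a i <= a j.
Proof. by move=> ij; exact: (homo_leq (@lexx _ _) (@le_trans _ _)). Qed.

Let telescope K i : \sum_(j < K) a (j + i.+1)%N - \sum_(j < K) a (j + i)%N =
  a (K + i)%N - a i.
Proof.
rewrite -sumrB; elim: K => [|K IH]; first by rewrite big_ord0 add0n subrr.
by rewrite big_ord_recr/= IH addSn addnS; ring.
Qed.

(** The increments of the averaged sequence [V] telescope: the i-th one is at least (a (K + i) - a
    i) / K, hence at least (a K - a I) / K whatever i < I. So [V] oscillates at least as much as the
    linear sequence of that slope, while Jensen's inequality carries the bound on the [v j] over to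
    [V]. *)
Lemma geometric_growth K : (a K - a I) * geo_osc `^ p^-1 <= K%:R * e.
Proof.
set l := a K - a I.
have [l0|l0] := leP l 0.
  by rewrite (@le_trans _ _ 0)// ?mulr_ge0// mulr_le0_ge0 ?powR_ge0.
have K0 : (0 < K)%N.
  by rewrite lt0n; apply: contraTneq l0 => K0; rewrite -leNgt /l K0 subr_le0 a_homo.
have KR : 0 < K%:R :> R by rewrite ltr0n.
pose V i := (\sum_(j < K) v j i) / K%:R.
have V_osc : weighted_osc p I.+1 geo_weight V <= e `^ p.
  have Vmean : weighted_mean I.+1 geo_weight V = (\sum_(j < K) m j) / K%:R.
    rewrite /weighted_mean /V; under eq_bigr do rewrite mulrA mulr_sumr.
    rewrite -mulr_suml exchange_big/=; congr (_ / _).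
    by apply: eq_bigr => j _; rewrite -v_mean.
  rewrite /weighted_osc Vmean.
  apply: (@le_trans _ _ (\sum_(i < I.+1)
      geo_weight i * ((\sum_(j < K) `|v j i - m j| `^ p) / K%:R))).
    apply: ler_sum => i _; apply: ler_wpM2l; first exact: geo_weight_ge0.
    rewrite /V -mulrBl -sumrB.
    exact: (powR_jensen p_gt1 (fun j => v j i - m j)).
  under eq_bigr do rewrite mulrA mulr_sumr.
  rewrite -mulr_suml exchange_big/= ler_pdivrMr//.
  apply: (@le_trans _ _ (\sum_(j < K) e `^ p)); last first.
    by rewrite sumr_const card_ord mulr_natr.
  apply: ler_sum => j _; apply: le_trans (v_osc j).
  by rewrite /weighted_osc v_mean.
have step i : (i < I)%N -> l / K%:R <= V i.+1 - V i.
  move=> iI; rewrite /V -mulrBl ler_wpM2r ?invr_ge0 ?(ltW KR)//.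
  have -> : \sum_(j < K) v j i = \sum_(j < K) a (j + i)%N.
    by apply: eq_bigr => j _; rewrite /v iI.
  apply: (@le_trans _ _ (a (K + i)%N - a i)); rewrite /l.
    by rewrite lerB// a_homo//; lia.
  rewrite -telescope lerD2r; apply: ler_sum => j _.
  (* At [i.+1 = I] the sequence takes its values in [m], which by [am] only enlarges the
     increment. *)
  rewrite /v; case: ifPn => // iI'.
  by have -> : I = i.+1 by [lia]; exact: am.
have V_nd i j : (i <= j < I.+1)%N ->
    V i - l / K%:R * i%:R <= V j - l / K%:R * j%:R.
  case/andP; elim: j => [|j IH]; first by rewrite leqn0 => /eqP ->.
  rewrite leq_eqVlt => /orP[/eqP ->//|]; rewrite ltnS => ij jI.
  apply: (le_trans (IH ij (ltnW jI))).
  have := step j jI; rewrite -natr1; lra.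
have : weighted_osc p I.+1 geo_weight (fun i => l / K%:R * i%:R) <= e `^ p.
  apply: le_trans V_osc; apply: weighted_osc_comonotone => //;
    [exact: geo_weight_ge0|exact: geo_weight_sum|].
  move=> i j /andP[ij _]; rewrite ler_wpM2l ?ler_nat//.
  by rewrite divr_ge0// ltW.
rewrite weighted_osc_scale//; last by rewrite divr_ge0// ltW.
rewrite -/geo_osc => h.
have {h} : ((l / K%:R) `^ p * geo_osc) `^ p^-1 <= (e `^ p) `^ p^-1.
  apply: ge0_ler_powR => //; rewrite ?nnegrE ?powR_ge0//.
    by rewrite invr_ge0 ltW.
  by rewrite mulr_ge0 ?powR_ge0 ?geo_osc_ge0.
rewrite powRM ?powR_ge0 ?geo_osc_ge0// -!powRrM divff ?gt_eqF//.
rewrite !powRr1// ?divr_ge0 ?(ltW l0)//.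
by rewrite mulrAC ler_pdivrMr// [e * _]mulrC.
Qed.

End growth.

(** * The rising sun lemma *)

Section rising_set.
Context {R : realType}.

(* Comparing with [Num.min (F x) (F a)] instead of [F x] adds the points where
   [F a < F x], so that the component starting at [a], if any, is no exception to
   [rising_component]. *)
Definition rising (F : R -> R) (a b : R) : set R :=
  [set x | a < x < b /\ exists2 y, x < y <= b & Num.min (F x) (F a) < F y].

Section rising.
Variables (F : R -> R) (a b : R).
Hypotheses (cF : continuous F) (ab : a < b) (Fba : F b <= F a).

Lemma rising_open : open (rising F a b).
Proof.
rewrite openE => x [/andP[ax xb] [y /andP[xy yb] hy]].
rewrite /interior.
have H1 : \forall z \near x, a < z < b.
  near=> z; apply/andP; split; near: z.
  - exact: lt_nbhsr.
  - exact: lt_nbhsl.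
have H2 : \forall z \near x, z < y by exact: lt_nbhsl.
have H3 : \forall z \near x, Num.min (F z) (F a) < F y.
  have [Fay|Fay] := ltP (F a) (F y).
    by near=> z; rewrite gt_min Fay orbT.
  have Fxy : F x < F y by move: hy; rewrite gt_min => /orP[//|]; rewrite ltNge Fay.
  near=> z; rewrite gt_min; apply/orP; left; near: z.
  exact: cvgr_lt _ (@cF x) _ Fxy.
near=> z; split; first by near: z.
exists y; last by near: z.
by rewrite yb andbT; near: z.
Unshelve. all: by end_near. Qed.

(** If F x > F a with x < b, continuity gives points just to the right of x with values above F a,
    so that x is in the set. Hence outside the set the minimum with F a is F x. *)
Lemma rising_notin x : a < x <= b -> ~ rising F a b x ->
  F x <= F a /\ forall y, x < y <= b -> F y <= F x.
Proof.
move=> /andP[ax]; rewrite le_eqVlt => /predU1P[->|xb nx].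
  move=> _; split=> // y /andP[h1 h2].
  by move: (lt_le_trans h1 h2); rewrite ltxx.
have h y : x < y <= b -> F y <= Num.min (F x) (F a).
  move=> xyb; rewrite leNgt; apply/negP => hy; apply: nx.
  by split; [rewrite ax xb | exists y].
suff Fxa : F x <= F a.
  by split=> // y /h; rewrite le_min => /andP[].
rewrite leNgt; apply/negP => Fax.
have [z [xz zb Faz]] : exists z, [/\ x < z, z <= b & F a < F z].
  have [z [z1 [z2 z3]]] := @filter_ex _ (x^'+) _ _ (filterI (nbhs_right_gt x)
    (filterI (nbhs_right_le xb) (cvgr_gt _ (cvg_at_right_filter (@cF x)) _ Fax))).
  by exists z.
have := h z; rewrite xz zb => /(_ isT); rewrite le_min => /andP[_].
by rewrite leNgt Faz.
Qed.

(** [rising_notin] gives F be <= F al. If this were strict, some x just to the right of al would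
    have F x > F be. The last point z of [x, be] with F z >= c is in the set, so some y > z has F y
    > c > F be. But y > be is impossible since be is not in the set, and y <= be contradicts the
    choice of z. *)
Lemma rising_component al be : al < be -> `]al, be[ `<=` rising F a b ->
  ~ rising F a b al -> ~ rising F a b be -> F al = F be.
Proof.
move=> albe sub nal nbe.
have [aal beb] : a <= al /\ be <= b.
  split; rewrite leNgt; apply/negP => h.
    (* The midpoint of ]al, min(a, be)[ would be a point of the set to the left of [a]. *)
    have : `]al, be[%classic (al + (Num.min a be - al) / 2).
      rewrite /= in_itv/=; case: (ltP a be) => ?; lra.
    by move/sub => -[/andP[]]; case: (ltP a be) => ?; lra.
  have : `]al, be[%classic (be - (be - Num.max b al) / 2).
    rewrite /= in_itv/=; case: (ltP b al) => ?; lra.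
  by move/sub => -[/andP[]]; case: (ltP b al) => ?; lra.
have abe : a < be <= b by rewrite (le_lt_trans aal).
have [Fbe_a Fbe] := rising_notin abe nbe.
have [Fal_a Fal] : F al <= F a /\ F be <= F al.
  move: aal; rewrite le_eqVlt => /predU1P[<-|aal]; first by [].
  have alb : a < al <= b by rewrite aal (le_trans (ltW albe)).
  have [? h] := rising_notin alb nal.
  by split=> //; apply: h; rewrite albe.
apply/eqP; rewrite eq_le Fal andbT leNgt; apply/negP => Fbeal.
have [x [alx xbe Fx]] : exists x, [/\ al < x, x < be & F be < F x].
  have [z [z1 [z2 z3]]] := @filter_ex _ (al^'+) _ _ (filterI (nbhs_right_gt al)
    (filterI (nbhs_right_lt albe) (cvgr_gt _ (cvg_at_right_filter (@cF al)) _ Fbeal))).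
  by exists z.
pose c := Num.min (F x) (F a).
have cbe : F be < c by rewrite lt_min Fx (lt_le_trans Fbeal).
pose S := `[x, be] `&` [set z | c <= F z].
have S0 : S !=set0.
  exists x; split; rewrite /= ?in_itv/= ?lexx ?(ltW xbe)//.
  by rewrite /c ge_min lexx.
have Sub : ubound S be by move=> z [/=]; rewrite in_itv/= => /andP[].
have clS : closed S.
  apply: closedI; first exact: itv_closed.
  apply: (@closed_comp _ _ F [set y | c <= y]); last exact: closed_ge.
  by move=> z _; exact: cF.
have Sz : S (sup S).
  have : has_ubound S by exists be.
  by move=> /(closure_sup S0); rewrite -((closure_id S).1 clS).
set z := sup S in Sz.
have [/= + cz] := Sz; rewrite in_itv/= => /andP[xz].
rewrite le_eqVlt => /predU1P[zbe|zbe].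
  by move: cz; rewrite zbe leNgt cbe.
have /sub[_ [y /andP[zy yb] hy]] : `]al, be[%classic z.
  by rewrite /= in_itv/= zbe (lt_le_trans alx).
have cy : c < F y.
  by apply: le_lt_trans hy; rewrite le_min cz /c ge_min lexx orbT.
have [ybe|ybe] := leP y be; last first.
  have := Fbe y; rewrite ybe yb => /(_ isT); rewrite leNgt => /negP; apply.
  exact: lt_trans cy.
have : y <= z.
  apply: sup_upper_bound; first by split => //; exists be.
  by split; rewrite /= ?in_itv/= ?ybe ?(ltW cy)// ?andbT (le_trans xz)// ltW.
by rewrite leNgt zy.
Qed.

(** No value of F to the right of such a point exceeds F x, so the right difference quotients are
    nonpositive. *)
Lemma rising_derive x : a < x < b -> ~ rising F a b x -> derivable F x 1 ->
  (F^`())%classic x <= 0.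
Proof.
move=> /andP[ax xb] nx dF.
have axb : a < x <= b by rewrite ax ltW.
have [_ h] := rising_notin axb nx.
rewrite derive1E.
have cv := cvg_dnbhs_at_right dF.
have -> : 'D_1 F x = lim (h^-1 *: ((F \o shift x) (h *: 1) - F x) @[h --> 0^'+]).
  by rewrite (cvg_lim _ cv).
apply: limr_le; first by apply/cvg_ex; eexists; exact: cv.
near=> t.
have t0 : 0 < t by [].
rewrite /GRing.scale/= mulr1 mulr_ge0_le0 ?invr_ge0 ?(ltW t0)// subr_le0.
apply: h; rewrite ltrDr t0/= -lerBrDr; near: t.
by apply: nbhs_right_le; rewrite subr_gt0.
Unshelve. all: by end_near. Qed.

End rising.
End rising_set.

Section rising_sun.
Context {R : realType}.
Notation mu := (@lebesgue_measure R).

Lemma integrable_cst_lty (A : set R) (r : R) : measurable A -> (mu A < +oo)%E ->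
  mu.-integrable A (EFin \o cst r).
Proof.
move=> mA Aoo; apply/integrableP; split; first exact/measurable_EFinP.
rewrite (eq_integral (cst `|r|%:E))// integral_cst//.
by rewrite lte_mul_pinfty ?lee_fin.
Qed.

Lemma integrable_subr (A : set R) (f : R -> R) (r : R) : measurable A ->
  (mu A < +oo)%E -> mu.-integrable A (EFin \o f) ->
  mu.-integrable A (EFin \o (fun x => f x - r)).
Proof.
move=> mA Aoo fA; rewrite (_ : _ \o _ = (EFin \o f) \- (EFin \o cst r))%E//.
by apply: integrableB => //; exact: integrable_cst_lty.
Qed.

Lemma Rintegral_subr (A : set R) (f : R -> R) (r : R) : measurable A ->
  (mu A < +oo)%E -> mu.-integrable A (EFin \o f) ->
  \int[mu]_(x in A) (f x - r) = \int[mu]_(x in A) f x - r * fine (mu A).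
Proof.
move=> mA Aoo fA; rewrite RintegralB//; first by rewrite Rintegral_cst.
exact: integrable_cst_lty.
Qed.

Lemma fine_mu_itv (b0 b1 : bool) (x y : R) : x <= y ->
  fine (mu [set` Interval (BSide b0 x) (BSide b1 y)]) = y - x.
Proof.
rewrite lebesgue_measure_itv/= lte_fin le_eqVlt => /predU1P[->|->].
  by rewrite ltxx subrr.
by rewrite -EFinB.
Qed.

Lemma mu_itv_lty (b0 b1 : bool) (x y : R) :
  (mu [set` Interval (BSide b0 x) (BSide b1 y)] < +oo)%E.
Proof. by rewrite lebesgue_measure_itv/=; case: ifP => // _; rewrite -EFinB ltry. Qed.

Lemma mu_sub_itv_lty (a b : R) (A : set R) : measurable A -> A `<=` `]a, b[ ->
  (mu A < +oo)%E.
Proof.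
move=> mA sA; apply: le_lt_trans (mu_itv_lty false true a b).
by apply: le_measure; rewrite ?inE.
Qed.

Lemma Rintegral_itv_oc (g : R -> R) (x y : R) : mu.-integrable setT (EFin \o g) ->
  x <= y -> \int[mu]_(t in `]-oo, y]) g t - \int[mu]_(t in `]-oo, x]) g t =
  \int[mu]_(t in `]x, y]) g t.
Proof.
move=> ig xy; apply: Rintegral_itvB => //.
exact: integrableS ig.
Qed.

(** Absolute continuity of the integral, applied to the interval between two nearby points. *)
Lemma primitive_continuous (g : R -> R) : mu.-integrable setT (EFin \o g) ->
  continuous (fun x => \int[mu]_(t in `]-oo, x]) g t).
Proof.
move=> ig x; apply/cvgrPdist_lt => /= e e0.
have [d [d0 dP]] := integral_normr_continuous ig e0.
have key (y z : R) : y <= z -> z < y + d ->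
    `|\int[mu]_(t in `]-oo, z]) g t - \int[mu]_(t in `]-oo, y]) g t| < e.
  move=> yz zyd; rewrite Rintegral_itv_oc//.
  have myz : (mu `]y, z] < d%:E)%E.
    by rewrite lebesgue_measure_itv/= lte_fin; case: ifPn => _;
      rewrite -?EFinB lte_fin//; lra.
  apply: le_lt_trans (dP `]y, z]%classic _ myz) => //.
  - by apply: le_normr_Rintegral => //; exact: integrableS ig.
near=> y.
have [h1 h2] : x - d < y /\ y < x + d.
  split; near: y; [apply: lt_nbhsr|apply: lt_nbhsl]; lra.
have [xy|/ltW yx] := leP x y.
  by rewrite distrC; exact: key.
by apply: key => //; lra.
Unshelve. all: by end_near. Qed.

Lemma open_interval_itv (X : set R) : open X -> is_interval X ->
  has_lbound X -> has_ubound X -> X = `]inf X, sup X[%classic.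
Proof.
move=> oX iX lX uX; rewrite {1}(_ : X = X°); last first.
  by apply/esym/interior_id.
by rewrite interval_bounded_interior//; apply/seteqP; split=> x /=; rewrite in_itv.
Qed.

(** [F] is the primitive of phi - lam, and the bound on the integral says that F b <= F a. On a
    component, F al = F be means that phi has average lam; off the components, F' = phi - lam is
    nonpositive almost everywhere by Lebesgue differentiation. The enumeration of the components may
    contain empty sets. *)
Lemma rising_sun (a b lam : R) (phi : R -> R) : a < b ->
  mu.-integrable `]a, b[ (EFin \o phi) ->
  \int[mu]_(x in `]a, b[) phi x <= lam * (b - a) ->
  exists I : nat -> set R, [/\ trivIset setT I,
    forall q, I q !=set0 -> exists al be : R, [/\ al < be, I q = `]al, be[%classic,
      I q `<=` `]a, b[ & \int[mu]_(x in I q) phi x = lam * (be - al)] &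
    {ae mu, forall x, x \in `]a, b[ -> ~ (\bigcup_q I q) x -> phi x <= lam}].
Proof.
move=> ab iphi phi_lam.
pose g := (fun x => phi x - lam) \_ `]a, b[.
have iphiB : mu.-integrable `]a, b[ (EFin \o (fun x => phi x - lam)).
  by apply: integrable_subr => //; exact: mu_itv_lty.
have ig : mu.-integrable setT (EFin \o g).
  by rewrite -restrict_EFin; apply/integrable_restrict => //; rewrite setTI.
pose F x := \int[mu]_(t in `]-oo, x]) g t.
have cF : continuous F by exact: primitive_continuous.
have FE x y : a <= x -> x <= y -> y <= b ->
    F y - F x = \int[mu]_(t in `]x, y[) phi t - lam * (y - x).
  move=> ax xy yb; rewrite /F Rintegral_itv_oc//.
  have sub : `]x, y[ `<=` `]a, b[ by apply: subset_itvW.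
  rewrite -Rintegral_itv_bndo_bndc; last exact: integrableS ig.
  rewrite /g -Rintegral_mkcondr setIidl// Rintegral_subr//.
  - by rewrite fine_mu_itv.
  - exact: mu_itv_lty.
  - exact: integrableS iphi.
have Fba : F b <= F a by rewrite -subr_le0 FE// ?(ltW ab)// subr_le0.
pose oU := rising_open (a := a) (b := b) cF.
pose I := open_disjoint_itv oU.
have UE : rising F a b = \bigcup_q I q by exact: open_disjoint_itv_bigcup.
have Usub : rising F a b `<=` `]a, b[.
  by move=> x [/andP[? ?] _]; rewrite /= in_itv/=; apply/andP.
have Isub q : I q `<=` rising F a b by rewrite UE; exact: bigcup_sup.
exists I; split; first exact: open_disjoint_itv_trivIset.
- move=> q [x Ix].
  have lI : has_lbound (I q).
    by exists a => z /Isub/Usub/=; rewrite in_itv/= => /andP[/ltW].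
  have uI : has_ubound (I q).
    by exists b => z /Isub/Usub/=; rewrite in_itv/= => /andP[_ /ltW].
  have IE := open_interval_itv (@open_disjoint_itv_open _ _ oU q)
    (@open_disjoint_itv_is_interval _ _ oU q) lI uI.
  rewrite -/(I q) in IE.
  set al := inf (I q) in IE; set be := sup (I q) in IE.
  have albe : al < be.
    by move: Ix; rewrite IE /= in_itv/= => /andP[]; exact: lt_trans.
  (* An endpoint in the open set would belong to another component, which is open and would
     therefore meet [I q]. *)
  have nend z : z = al \/ z = be -> ~ rising F a b z.
    rewrite UE => zE [r _ Irz].
    have [qr|qr] := eqVneq q r.
      by move: Irz; rewrite -qr IE /= in_itv/=; case: zE => ->; rewrite !ltxx ?andbF.
    have oIr : open (I r) by exact: open_disjoint_itv_open.
    have nIr : nbhs z (I r) by apply: open_nbhs_nbhs; split.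
    have [y [Iqy Iry]] : exists y, I q y /\ I r y.
      rewrite IE; case: zE => zE; rewrite zE in nIr.
        have [y [y1 [y2 y3]]] := @filter_ex _ (al^'+) _ _ (filterI (nbhs_right_gt al)
          (filterI (nbhs_right_lt albe)
            (@cvg_at_right_filter _ _ id al al cvg_id _ nIr))).
        by exists y; split => //; rewrite /= in_itv/= y1.
      have [y [y1 [y2 y3]]] := @filter_ex _ (be^'-) _ _ (filterI (nbhs_left_lt be)
          (filterI (nbhs_left_gt albe)
            (@cvg_at_left_filter _ _ id be be cvg_id _ nIr))).
      by exists y; split => //; rewrite /= in_itv/= y1 y2.
    have /trivIsetP/(_ q r Logic.I Logic.I qr) := open_disjoint_itv_trivIset (oU := oU).
    by move=> /seteqP[/(_ y)] h _; apply: h.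
  exists al, be; split => //; first by move=> z /Isub/Usub.
  have Iab : `]al, be[ `<=` rising F a b by rewrite -IE; exact: Isub.
  have := rising_component cF Fba albe Iab
    (nend _ (or_introl erefl)) (nend _ (or_intror erefl)).
  have aal : a <= al.
    by apply: lb_le_inf;
      [exists x|move=> z /Isub/Usub/=; rewrite in_itv/= => /andP[/ltW]].
  have beb : be <= b.
    by apply: ge_sup;
      [exists x|move=> z /Isub/Usub/=; rewrite in_itv/= => /andP[_ /ltW]].
  move=> Fe; have := FE _ _ aal (ltW albe) beb.
  by rewrite Fe subrr IE => /eqP; rewrite eq_sym subr_eq0 => /eqP.
- have locg : locally_integrable setT g by exact: integrable_locally.
  have igy (y : R) : mu.-integrable `]-oo, y] (EFin \o g) by exact: integrableS ig.
  have := FTC1Ny igy locg.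
  apply: filterS; first exact: (ae_filter_ringOfSetsType mu).
  move=> x [dF Fx] xab nx.
  have axb : a < x < b by move: xab; rewrite in_itv.
  rewrite -UE in nx.
  have := rising_derive cF Fba axb nx dF.
  by rewrite Fx /g patchE mem_set//= subr_le0.
Qed.
End rising_sun.

(** * The stopping set at a given level *)

Section stopping.
Context {R : realType}.
Notation mu := (@lebesgue_measure R).

Lemma EFin_Rintegral (A : set R) (f : R -> R) : measurable A ->
  mu.-integrable A (EFin \o f) ->
  (\int[mu]_(x in A) (f x)%:E)%E = (\int[mu]_(x in A) f x)%:E.
Proof. by move=> mA fA; rewrite /Rintegral fineK//; exact: integrable_fin_num. Qed.

Lemma integrable_measurable (A : set R) (f : R -> R) :
  mu.-integrable A (EFin \o f) -> measurable_fun A f.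
Proof. by move=> /integrableP[/measurable_EFinP]. Qed.

Lemma measurable_powR_osc (A : set R) (f : R -> R) (c p : R) :
  measurable_fun A f -> measurable_fun A (fun x => (`|f x - c| `^ p)%:E).
Proof.
move=> mf; apply/measurable_EFinP.
apply: (measurableT_comp (measurable_powR _)) => //.
by apply: measurableT_comp => //; apply: measurable_funB.
Qed.

Variables (p e a b : R) (phi : R -> R).
Hypotheses (p_gt1 : 1 < p) (ab : a < b).
Hypothesis iphi : mu.-integrable `]a, b[ (EFin \o phi).
Hypothesis osc_phi : forall al be : R, al < be -> `]al, be[ `<=` `]a, b[ ->
  (\int[mu]_(x in `]al, be[)
    (`|phi x - (\int[mu]_(y in `]al, be[) phi y) / (be - al)| `^ p)%:E <=
    (e `^ p * (be - al))%:E)%E.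

(** On each rising sun interval the average of phi is lam, so the oscillation hypothesis bounds the
    integral of |phi - lam|^p there, and these bounds add up. The null set [N] of the other points
    with phi > lam is added to the union so that the last clause holds at every point. *)
Lemma stopping_set (lam : R) : \int[mu]_(x in `]a, b[) phi x <= lam * (b - a) ->
  exists E : set R, [/\ measurable E, E `<=` `]a, b[,
    \int[mu]_(x in E) (phi x - lam) = 0,
    (\int[mu]_(x in E) (`|phi x - lam| `^ p)%:E <= (e `^ p)%:E * mu E)%E &
    forall x, x \in `]a, b[ -> ~ E x -> phi x <= lam].
Proof.
move=> philam.
have [I [tI IP philamI]] := rising_sun ab iphi philam.
have mI q : measurable (I q).
  by have [->//|/set0P/IP[al [be [_ -> _ _]]]] := eqVneq (I q) set0.
set E0 := \bigcup_q I q in philamI.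
have mE0 : measurable E0 by exact: bigcupT_measurable.
have subE0 : E0 `<=` `]a, b[.
  by move=> x [q _ Iqx]; have [|al [be [_ _ + _]]] := IP q; [exists x | apply].
have mphi : measurable_fun `]a, b[ phi by exact: integrable_measurable.
have mpos : measurable (`]a, b[ `&` [set x | lam < phi x]).
  rewrite -preimage_itvoy; exact: mphi.
pose N := (`]a, b[ `&` [set x | lam < phi x]) `\` E0.
have mN : measurable N by exact: measurableD.
have N0 : mu N = 0%E.
  case: philamI => M [mM M0 subM]; apply: (subset_measure0 _ _ _ M0) => //.
  move=> x [[/= xab lamx] nE]; apply: subM => /= h.
  by have := h xab nE; rewrite leNgt lamx.
have dE0N : [disjoint E0 & N].
  by rewrite disj_set2E; apply/eqP/seteqP; split => // x [h [_]].
have subE : E0 `|` N `<=` `]a, b[ by move=> x [/subE0//|[[]]].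
have iB (A : set R) : measurable A -> A `<=` `]a, b[ ->
    mu.-integrable A (EFin \o (fun x => phi x - lam)).
  move=> mA sA; apply: integrable_subr => //; last exact: integrableS iphi.
  exact: mu_sub_itv_lty sA.
exists (E0 `|` N); split => //; first exact: measurableU.
- rewrite Rintegral_setU//; last exact: iB (measurableU _ _ _ _) _.
  rewrite [X in _ + X](_ : _ = 0) ?addr0; last first.
    rewrite /Rintegral null_set_integral//.
    by apply/measurable_EFinP; apply: integrable_measurable; apply: iB => // x [[]].
  rewrite /Rintegral integral_bigcup//; last exact: iB.
  rewrite eseries0// => q _ _.
  have [->|/set0P/IP[al [be [albe Iq sIq intq]]]] := eqVneq (I q) set0.
    by rewrite integral_set0.
  rewrite EFin_Rintegral//; last exact: iB.
  rewrite Rintegral_subr//.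
  + by rewrite intq Iq fine_mu_itv ?ltW// subrr.
  + by rewrite Iq; exact: mu_itv_lty.
  + by apply: integrableS iphi => //; exact: mI.
- have mosc (A : set R) : A `<=` `]a, b[ ->
      measurable_fun A (fun x => (`|phi x - lam| `^ p)%:E).
    by move=> sA; apply: measurable_powR_osc; exact: measurable_funS mphi.
  rewrite (@integral_setU _ _ _ mu E0 N)//; last exact: mosc.
  rewrite [X in (_ + X)%E]null_set_integral ?adde0//; last first.
    by apply: mosc => x [[]].
  have -> : mu (E0 `|` N) = mu E0.
    have E0N : E0 `&` N = set0 by apply/eqP; rewrite -disj_set2E.
    by have := measureU mu mE0 mN E0N; rewrite [X in (_ + X)%E]N0 adde0.
  rewrite (@ge0_integral_bigcup _ _ _ mu I)//; last exact: mosc.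
  rewrite measure_bigcup//=; last by move=> q _; exact: mI.
  rewrite [X in (_ * X)%E](_ : _ = \sum_(0 <= q <oo) mu (I q))%E; last first.
    by apply: eq_eseriesl => q; rewrite in_setT.
  rewrite -nneseriesZl//.
  apply: lee_nneseries => [q _ _|q _].
    by apply: integral_ge0 => x _; rewrite lee_fin powR_ge0.
  have [->|/set0P/IP[al [be [albe Iq sIq intq]]]] := eqVneq (I q) set0.
    by rewrite integral_set0 measure0 mule0.
  have := osc_phi albe; rewrite -Iq => /(_ sIq).
  rewrite intq mulfK; last by rewrite subr_eq0 gt_eqF.
  move=> /le_trans; apply; rewrite Iq lebesgue_measure_itv/= lte_fin albe.
  by rewrite -EFinB -EFinM.
- move=> x xab nE; rewrite leNgt; apply/negP => lamx.
  by apply: (nE); right; split; [split|move=> E0x; apply: (nE); left].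
Qed.
End stopping.

(** * Superlevel sets *)

Section top_sets.
Context {R : realType}.
Notation mu := (@lebesgue_measure R).

Lemma integral_setID (A B : set R) (f : R -> R) : measurable A -> measurable B ->
  measurable_fun A f ->
  (\int[mu]_(x in A) (f x)%:E =
   \int[mu]_(x in A `&` B) (f x)%:E + \int[mu]_(x in A `\` B) (f x)%:E)%E.
Proof.
move=> mA mB mf; rewrite -{1}(setUIDK A B) integral_setU//.
- exact: measurableI.
- exact: measurableD.
- by rewrite setUIDK; exact/measurable_EFinP.
- by rewrite disj_set2E setIDA setIAC -setIDA setDv setI0.
Qed.

Lemma Rintegral_setID (A B : set R) (f : R -> R) : measurable A -> measurable B ->
  mu.-integrable A (EFin \o f) ->
  \int[mu]_(x in A) f x =
   \int[mu]_(x in A `&` B) f x + \int[mu]_(x in A `\` B) f x.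
Proof.
move=> mA mB intf; rewrite -{1}(setUIDK A B) Rintegral_setU//.
- exact: measurableI.
- exact: measurableD.
- by rewrite setUIDK.
- by rewrite disj_set2E setIDA setIAC -setIDA setDv setI0.
Qed.

Variables (p e a b : R) (phi : R -> R).
Hypotheses (p_gt1 : 1 < p) (ab : a < b).
Hypothesis iphi : mu.-integrable `]a, b[ (EFin \o phi).
Hypothesis osc_phi : forall al be : R, al < be -> `]al, be[ `<=` `]a, b[ ->
  (\int[mu]_(x in `]al, be[)
    (`|phi x - (\int[mu]_(y in `]al, be[) phi y) / (be - al)| `^ p)%:E <=
    (e `^ p * (be - al))%:E)%E.

Let mu_lty (A : set R) : measurable A -> A `<=` `]a, b[ -> (mu A < +oo)%E.
Proof. exact: mu_sub_itv_lty. Qed.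

Let mu_fine (A : set R) : measurable A -> A `<=` `]a, b[ -> mu A = (fine (mu A))%:E.
Proof. by move=> mA sA; rewrite fineK// ge0_fin_numE// mu_lty. Qed.

Let iB (A : set R) (c : R) : measurable A -> A `<=` `]a, b[ ->
  mu.-integrable A (EFin \o (fun x => phi x - c)).
Proof.
move=> mA sA; apply: integrable_subr => //; last exact: integrableS iphi.
exact: mu_lty.
Qed.

(* The stopping set [E] at level [m] contains [D] intersected with [phi > m] and has
   the same deficit [int (m - phi)^+] as [D].  Since [D] consists of the points where
   the deficit is smallest, spreading it over [D] lowers its p-th moment and raises
   the measure of its support. *)
Lemma top_set_osc (D : set R) (th : R) : measurable D -> D `<=` `]a, b[ ->
  (0 < mu D)%E -> (forall x, D x -> th <= phi x) ->
  (forall x, (`]a, b[ `\` D) x -> phi x <= th) ->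
  (\int[mu]_(x in D)
    (`|phi x - (\int[mu]_(y in D) phi y) / fine (mu D)| `^ p)%:E <=
    (e `^ p)%:E * mu D)%E.
Proof.
move=> mD sD D0 Dth cDth.
have mJ : measurable (`]a, b[%classic : set R) by [].
set d := fine (mu D); have muD : mu D = d%:E by exact: mu_fine.
have d0 : 0 < d by rewrite -lte_fin -muD.
set m := _ / d.
pose g x := phi x - m.
have ig A : measurable A -> A `<=` `]a, b[ -> mu.-integrable A (EFin \o g).
  exact: iB.
have mg A : measurable A -> A `<=` `]a, b[ -> measurable_fun A g.
  by move=> mA sA; apply: integrable_measurable; exact: ig.
have iphiD : mu.-integrable D (EFin \o phi) by exact: integrableS iphi.
have intD0 : \int[mu]_(x in D) g x = 0.
  rewrite Rintegral_subr//; last exact: mu_lty.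
  by rewrite -/d /m divfK ?subrr// gt_eqF.
have thm : th <= m.
  rewrite /m ler_pdivlMr// -Rintegral_cst//; apply: le_Rintegral => //.
  by apply: integrable_cst_lty => //; exact: mu_lty.
(* Off [D], phi is at most th, hence at most m: the average over the whole interval is at most m, as
   [stopping_set] requires. *)
have phim : \int[mu]_(x in `]a, b[) phi x <= m * (b - a).
  rewrite -subr_le0.
  have := @Rintegral_subr _ `]a, b[%classic phi m mJ (mu_itv_lty _ _ _ _) iphi.
  rewrite fine_mu_itv ?(ltW ab)// => <-.
  rewrite (@Rintegral_setID _ D) ?setIidr//; last exact: ig.
  rewrite intD0 add0r -oppr_ge0.
  have mJD : measurable (`]a, b[ `\` D) by exact: measurableD.
  have <- : \int[mu]_(x in `]a, b[ `\` D) (- 1 * g x) =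
      - \int[mu]_(x in `]a, b[ `\` D) g x.
    by rewrite RintegralZl ?mulN1r//; apply: ig.
  apply: Rintegral_ge0 => x Dx; rewrite mulN1r oppr_ge0 subr_le0.
  by apply: le_trans thm; exact: cDth.
have [E [mE sE intE0 oscE Em]] := stopping_set ab iphi osc_phi phim.
have mDE : measurable (D `\` E) by exact: measurableD.
have mED : measurable (E `\` D) by exact: measurableD.
have sDE : D `\` E `<=` `]a, b[ by move=> x [/sD].
have sED : E `\` D `<=` `]a, b[ by move=> x [/sE].
have sIDE : D `&` E `<=` `]a, b[ by move=> x [/sD].
(* The integrals of g over [D] and over [E] both vanish, and the common part cancels. *)
have intDE : \int[mu]_(x in D `\` E) g x = \int[mu]_(x in E `\` D) g x.
  have h1 : \int[mu]_(x in D) g x = _ := Rintegral_setID mD mE (ig _ mD sD).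
  have h2 : \int[mu]_(x in E) g x = _ := Rintegral_setID mE mD (ig _ mE sE).
  move: h1 h2; rewrite intD0 /g intE0 -/g setIC => h1 h2.
  by apply: (@addrI _ (\int[mu]_(x in E `&` D) g x)); rewrite -h1 -h2.
pose dl := m - th.
have dl0 : 0 <= dl by rewrite subr_ge0.
have gDE x : (D `\` E) x -> - dl <= g x <= 0.
  move=> DEx; have [Dx nEx] := DEx; rewrite subr_le0 Em// ?andbT.
    by rewrite /dl /g opprB lerD2r Dth.
  by rewrite inE; exact: sDE.
have gED x : (E `\` D) x -> g x <= - dl.
  move=> [Ex nDx]; rewrite /g /dl opprB lerD2r; apply: cDth; split => //.
  exact: sE.
have mosc A : measurable A -> A `<=` `]a, b[ ->
    measurable_fun A (fun x => (`|g x| `^ p)%:E).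
  move=> mA sA; apply: measurable_powR_osc; apply: integrable_measurable.
  exact: integrableS iphi.
have p0 : 0 < p by exact: lt_trans p_gt1.
(* If m = th, then g >= 0 on [D] with integral 0, so g vanishes almost everywhere on [D] and the
   left-hand side is 0. *)
move: dl0; rewrite le_eqVlt => /predU1P[dl0|dl0].
  have g0 x : D x -> 0 <= g x.
    by move=> Dx; rewrite subr_ge0 (le_trans _ (Dth x Dx))// -subr_le0 -/dl -dl0.
  have iD0 : (\int[mu]_(x in D) `|(EFin \o g) x| = 0)%E.
    transitivity (\int[mu]_(x in D) (g x)%:E)%E.
      by apply: eq_integral => x; rewrite inE => /g0 gx; rewrite /= ger0_norm.
    by rewrite EFin_Rintegral// ?intD0//; exact: ig.
  have mgD : measurable_fun D (EFin \o g) by apply/measurable_EFinP; exact: mg.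
  have ae0 := (ae_eq_integral_abs mu mD mgD).1 iD0.
  rewrite (@ge0_ae_eq_integral _ _ _ mu D _ (cst 0%E))//.
  - by rewrite integral0 mule_ge0// lee_fin powR_ge0.
  - exact: mosc.
  - case: ae0 => N [mN N0 sN]; exists N; split => //.
    apply: subset_trans sN => x /= nh h; apply: nh => Dx.
    by have [gx0] := h Dx; rewrite -/(g x) gx0 normr0 powR0// gt_eqF.
(* The two differences carry the same integral of g, with g >= - dl on [D] minus [E] and g <= - dl
   on [E] minus [D]: the latter cannot be larger. *)
have muED : (mu E <= mu D)%E.
  have splitmu A B : measurable A -> measurable B ->
      mu A = (mu (A `&` B) + mu (A `\` B))%E.
    by move=> mA mB; rewrite addeC -measureDI.
  rewrite (splitmu E D)// (splitmu D E)// setIC leeD2l//.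
  rewrite (mu_fine mED sED) (mu_fine mDE sDE) lee_fin -(ler_pM2l dl0).
  rewrite -lerN2 -!mulNr -!Rintegral_cst//.
  apply: (@le_trans _ _ (\int[mu]_(x in D `\` E) g x)).
    apply: le_Rintegral => //; [|exact: ig|by move=> x /gDE/andP[]].
    by apply: integrable_cst_lty => //; exact: mu_lty.
  rewrite intDE; apply: le_Rintegral => //; [exact: ig|].
  by apply: integrable_cst_lty => //; exact: mu_lty.
apply: (@le_trans _ _ ((e `^ p)%:E * mu E)%E); last first.
  by rewrite lee_wpmul2l// lee_fin powR_ge0.
apply: le_trans oscE; rewrite -/g.
have mpow A : measurable A -> A `<=` `]a, b[ -> measurable_fun A (fun x => `|g x| `^ p).
  by move=> mA sA; apply/measurable_EFinP; exact: mosc.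
rewrite (integral_setID mD mE); last exact: mpow.
rewrite (integral_setID mE mD); last exact: mpow.
rewrite setIC leeD2l//.
have pw (u v : R) : 0 <= u -> u <= v -> u `^ (p - 1) <= v `^ (p - 1).
  move=> u0 uv; apply: ge0_ler_powR => //; first by rewrite subr_ge0 ltW.
  by rewrite nnegrE (le_trans u0).
(* On both differences g <= 0, so h is dl^(p-1) |g|. It dominates |g|^p on [D] minus [E], where |g|
   <= dl, and is dominated by it on [E] minus [D], where |g| >= dl; its integrals over the two sets
   agree. *)
pose h x := - (dl `^ (p - 1)) * g x.
have ih A : measurable A -> A `<=` `]a, b[ -> mu.-integrable A (EFin \o h).
  move=> mA sA; rewrite (_ : _ \o _ =
    (fun x => (- (dl `^ (p - 1)))%:E * (EFin \o g) x)%E).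
    by apply: integrableZl => //; exact: ig.
  by apply/funext.
apply: (@le_trans _ _ (\int[mu]_(x in D `\` E) (h x)%:E)%E).
  apply: ge0_le_integral => //.
  - exact: mosc.
  - by apply/measurable_EFinP; apply: integrable_measurable; exact: ih.
  - move=> x /gDE/andP[g1 g2]; rewrite lee_fin /h mulNr -mulrN.
    rewrite ler0_norm// -mulr_powRB1 ?oppr_ge0// mulrC ler_wpM2r ?oppr_ge0//.
    by apply: pw; rewrite ?oppr_ge0// lerNl.
have -> : (\int[mu]_(x in D `\` E) (h x)%:E = \int[mu]_(x in E `\` D) (h x)%:E)%E.
  rewrite !EFin_Rintegral//; [|exact: ih|exact: ih].
  by rewrite /h !RintegralZl// ?intDE//; exact: ig.
apply: ge0_le_integral => //.
- move=> x /gED gx; rewrite lee_fin /h mulNr -mulrN mulr_ge0 ?powR_ge0//.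
  by rewrite oppr_ge0 (le_trans gx)// oppr_le0 ltW.
- by apply/measurable_EFinP; apply: integrable_measurable; exact: ih.
- exact: mosc.
- move=> x /gED gx; rewrite lee_fin /h mulNr -mulrN.
  have gx0 : g x <= 0 by rewrite (le_trans gx)// oppr_le0 ltW.
  rewrite ler0_norm// -(@mulr_powRB1 _ (- g x)) ?oppr_ge0// mulrC ler_wpM2l ?oppr_ge0//.
  by apply: pw; rewrite ?(ltW dl0)// lerNr.
Qed.
End top_sets.

(** * Superlevel sets of prescribed measure *)

Section top_subset.
Context {R : realType}.
Notation mu := (@lebesgue_measure R).

Lemma mu_bigcup_le (F : (set R)^nat) (t : \bar R) : (forall n, measurable (F n)) ->
  nondecreasing_seq F -> (forall n, mu (F n) <= t)%E -> (mu (\bigcup_n F n) <= t)%E.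
Proof.
move=> mF ndF Ft.
have cv : mu \o F @ \oo --> mu (\bigcup_n F n).
  by apply: nondecreasing_cvg_mu => //; exact: bigcupT_measurable.
rewrite -(cvg_lim _ cv)//; apply: lime_le; first by apply/cvg_ex; eexists; exact: cv.
by apply: nearW => n; exact: Ft.
Qed.

Lemma mu_bigcap_ge (F : (set R)^nat) (t : \bar R) : (forall n, measurable (F n)) ->
  (mu (F 0%N) < +oo)%E ->
  nonincreasing_seq F -> (forall n, t <= mu (F n))%E -> (t <= mu (\bigcap_n F n))%E.
Proof.
move=> mF F0 niF Ft.
have cv : mu \o F @ \oo --> mu (\bigcap_n F n).
  by apply: nonincreasing_cvg_mu => //; exact: bigcapT_measurable.
rewrite -(cvg_lim _ cv)//; apply: lime_ge; first by apply/cvg_ex; eexists; exact: cv.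
by apply: nearW => n; exact: Ft.
Qed.

(** Intermediate value theorem for the measure of the part of B to the left of x, a continuous
    function of x. *)
Lemma subset_of_measure (a b : R) (B : set R) (t : R) : a <= b -> measurable B ->
  B `<=` `]a, b[ -> 0 <= t -> (t%:E <= mu B)%E ->
  exists B', [/\ measurable B', B' `<=` B & mu B' = t%:E].
Proof.
move=> ab mB sB t0 tB.
have Boo : (mu B < +oo)%E by exact: mu_sub_itv_lty sB.
pose g : R -> R := \1_B.
have ig : mu.-integrable setT (EFin \o g).
  rewrite (_ : EFin \o g = (EFin \o cst 1) \_ B).
    by apply/integrable_restrict => //; rewrite setTI; exact: integrable_cst_lty.
  by apply/funext => x; rewrite /g /= indicE patchE; case: ifP.
pose F x := \int[mu]_(t in `]-oo, x]) g t.
have cF : continuous F by exact: primitive_continuous.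
have FE x : F x = fine (mu (B `&` `]-oo, x])).
  by rewrite /F /Rintegral integral_indic// setIC.
have Fa : F a = 0.
  rewrite FE (_ : _ `&` _ = set0) ?measure0//.
  apply/seteqP; split => // x [/sB/=]; rewrite !in_itv/= => /andP[ax _].
  by rewrite leNgt ax.
have Fb : F b = fine (mu B).
  rewrite FE setIidl// => x /sB/=; rewrite !in_itv/= => /andP[_ /ltW//].
have [||c cab Fc] := @IVT _ F a b t ab.
- by apply: continuous_subspaceT => x; exact: cF.
- rewrite Fa Fb.
  have tB' : t <= fine (mu B).
    by rewrite -lee_fin fineK// ge0_fin_numE.
  by rewrite ge_min t0/= le_max tB' orbT.
- exists (B `&` `]-oo, c]); split => //; first exact: measurableI.
  rewrite -Fc FE fineK// ge0_fin_numE//.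
  by apply: le_lt_trans Boo; apply: le_measure; rewrite ?inE//; exact: measurableI.
Qed.

(** With th the supremum of the levels l for which phi > l on a set of measure above t, continuity
    of the measure places t between the measures of {phi > th} and {phi >= th}. [D'] is the former
    set completed by a piece of {phi = th}. *)
Lemma top_subset (a b : R) (D : set R) (phi : R -> R) (t : R) : a <= b -> measurable D ->
  D `<=` `]a, b[ -> measurable_fun D phi -> 0 < t -> (t%:E < mu D)%E ->
  exists D' th, [/\ measurable D', D' `<=` D, mu D' = t%:E,
    forall x, D' x -> th <= phi x & forall x, (D `\` D') x -> phi x <= th].
Proof.
move=> ab mD sD mphi t0 tD.
have Doo : (mu D < +oo)%E by exact: mu_sub_itv_lty sD.
pose G l := D `&` [set x | l < phi x].
have mG l : measurable (G l) by rewrite /G -preimage_itvoy; exact: mphi.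
have GD l : G l `<=` D by exact: subIsetl.
have Gle l l' : l <= l' -> G l' `<=` G l.
  by move=> ll' x [Dx /=] h; split => //=; exact: le_lt_trans h.
have muG l l' : l <= l' -> (mu (G l') <= mu (G l))%E.
  by move=> ll'; apply: le_measure; rewrite ?inE; [exact: mG|exact: mG|exact: Gle].
have Goo l : (mu (G l) < +oo)%E.
  apply: le_lt_trans Doo; apply: le_measure; rewrite ?inE; [exact: mG|by []|exact: GD].
pose S := [set l | (t%:E < mu (G l))%E].
have S0 : S !=set0.
  apply: contrapT => nS.
  suff : (mu D <= t%:E)%E by rewrite leNgt tD.
  have -> : D = \bigcup_n G (- n%:R).
    apply/seteqP; split => [x Dx|x [n _ []]//].
    exists (Num.bound `|phi x|) => //; split => //=.
    by rewrite ltrNl (le_lt_trans (ler_norm _))// normrN archi_boundP.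
  apply: mu_bigcup_le.
    by move=> n; exact: mG.
    move=> m n mn; apply/subsetPset => /=; apply: Gle.
    by rewrite lerN2 ler_nat.
  by move=> n; rewrite leNgt; apply/negP => h; apply: nS; exists (- n%:R).
have [l0 Gl0] : exists l0, (mu (G l0) <= t%:E)%E.
  apply: contrapT => nS.
  have : (t%:E <= mu (\bigcap_n G n%:R))%E.
    apply: mu_bigcap_ge.
    - by move=> n; exact: mG.
    - exact: Goo.
    - by move=> m n mn; apply/subsetPset => /=; apply: Gle; rewrite ler_nat.
    - by move=> n; rewrite ltW// ltNge; apply/negP => h; apply: nS; exists n%:R.
  rewrite (_ : \bigcap_n _ = set0) ?measure0 ?lee_fin ?leNgt ?t0//.
  apply/seteqP; split => // x /(_ (Num.bound `|phi x|) Logic.I) [_ /=].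
  rewrite ltNge => /negP; apply.
  by rewrite ltW// (le_lt_trans (ler_norm _))// archi_boundP.
have Sub : has_ubound S.
  exists l0 => l /= h; rewrite leNgt; apply/negP => ll.
  have : (t%:E < mu (G l))%E := h.
  by rewrite ltNge (le_trans (muG _ _ (ltW ll))).
pose th := sup S.
have Gth : (mu (G th) <= t%:E)%E.
  have -> : G th = \bigcup_n G (th + n.+1%:R^-1).
    apply/seteqP; split => [x [Dx /= h]|x [n _ [Dx /= h]]]; last first.
      by split => //=; apply: lt_trans h; rewrite ltrDl invr_gt0.
    have := ltr_add_invr h => -[n hn].
    by exists n.
  apply: mu_bigcup_le.
    by move=> n; exact: mG.
    move=> m n mn; apply/subsetPset => /=; apply: Gle.
    by rewrite lerD2l lef_pV2 ?posrE// ler_nat ltnS.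
  move=> n; rewrite leNgt; apply/negP => h.
  have := sup_upper_bound (conj S0 Sub) h.
  by rewrite leNgt ltrDl invr_gt0 ltr0n.
pose H := D `&` [set x | th <= phi x].
have mH : measurable H by rewrite /H -preimage_itvcy; exact: mphi.
have Hth : (t%:E <= mu H)%E.
  have -> : H = \bigcap_n G (th - n.+1%:R^-1).
    apply/seteqP; split => [x [Dx /= h] n _|x h].
      by split => //=; apply: lt_le_trans h; rewrite gtrDl oppr_lt0 invr_gt0.
    split; first by have [] := h 0%N Logic.I.
    rewrite /= leNgt; apply/negP => /ltr_add_invr[n hn].
    have [_ /=] := h n Logic.I; rewrite ltNge => /negP; apply.
    by rewrite lerBrDr ltW.
  apply: mu_bigcap_ge.
  - by move=> n; exact: mG.
  - exact: Goo.
  - move=> m n mn; apply/subsetPset => /=; apply: Gle.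
    by rewrite lerD2l lerN2 lef_pV2 ?posrE// ler_nat ltnS.
  - move=> n.
    have n0 : 0 < n.+1%:R^-1 :> R by rewrite invr_gt0.
    have [l Sl hl] := sup_adherent n0 (conj S0 Sub).
    by apply: le_trans (ltW Sl) _; apply: muG; exact: ltW.
pose B := H `\` G th.
have mB : measurable B by exact: measurableD.
have GH : G th `<=` H by move=> x [Dx /= /ltW].
have muH : mu H = (mu (G th) + mu B)%E.
  have GB : G th `&` B = set0 by exact: setDIK.
  by have := measureU mu (mG th) mB GB; rewrite /B setDUK.
have Gfin : mu (G th) \is a fin_num.
  by rewrite ge0_fin_numE//; exact: Goo.
have [B' [mB' sB' muB']] : exists B',
    [/\ measurable B', B' `<=` B & mu B' = (t - fine (mu (G th)))%:E].
  apply: (@subset_of_measure a b) => //.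
  - by move=> x [[/sD]].
  - by rewrite subr_ge0 -lee_fin fineK.
  - by rewrite EFinB fineK// leeBlDl// -muH.
exists (G th `|` B'), th; split.
- exact: measurableU.
- by move=> x [/GD//|/sB'[[]]].
- have GB' : G th `&` B' = set0 by apply/seteqP; split => // x [Gx /sB'[_]].
  have -> : mu (G th `|` B') = (mu (G th) + mu B')%E.
    by exact: (measureU mu (mG th) mB' GB').
  by rewrite [X in (_ + X)%E]muB' -[X in (X + _)%E](fineK Gfin) -EFinD addrC subrK.
- by move=> x [[_ /= /ltW]//|/sB'[[]]].
- move=> x [Dx nD]; rewrite leNgt; apply/negP => h; apply: nD; left.
  by split.
Qed.
End top_subset.

(** * Nested superlevel sets of geometrically decreasing measures *)

Section top_sequence.
Context {R : realType}.
Notation mu := (@lebesgue_measure R).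

Lemma le_of_eq (x y : R) : x = y -> x <= y.
Proof. by move=> ->. Qed.

(** The tangent inequality at the average is integrated; its linear term has integral 0. If the
    right-hand side is infinite there is nothing to prove. *)
Lemma avg_jensen (p : R) (A : set R) (f : R -> R) (s c : R) : 1 < p ->
  measurable A -> mu A = s%:E -> 0 < s -> mu.-integrable A (EFin \o f) ->
  ((s * `|(\int[mu]_(x in A) f x) / s - c| `^ p)%:E <=
   \int[mu]_(x in A) (`|f x - c| `^ p)%:E)%E.
Proof.
move=> p1 mA muA s0 fA.
have Aoo : (mu A < +oo)%E by rewrite muA ltry.
have mosc : measurable_fun A (fun x => (`|f x - c| `^ p)%:E).
  by apply: measurable_powR_osc; exact: integrable_measurable.
have I0 : (0 <= \int[mu]_(x in A) (`|f x - c| `^ p)%:E)%E.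
  by apply: integral_ge0 => x _; rewrite lee_fin powR_ge0.
set m := _ / s.
have [Ioo|Ioo] := eqVneq (\int[mu]_(x in A) (`|f x - c| `^ p)%:E)%E +oo%E.
  by rewrite Ioo leey.
have iosc : mu.-integrable A (EFin \o (fun x => `|f x - c| `^ p)).
  apply/integrableP; split => //.
  rewrite (_ : (\int[mu]_(x in A) _)%E = \int[mu]_(x in A) (`|f x - c| `^ p)%:E)%E.
    by rewrite ltey.
  by apply: eq_integral => x _; rewrite /= ger0_norm ?powR_ge0.
rewrite EFin_Rintegral// lee_fin.
pose k := p * spow p (m - c).
have iF : mu.-integrable A (EFin \o (fun x => f x - m)) by exact: integrable_subr.
have ik : mu.-integrable A (EFin \o (fun x => k * (f x - m))).
  rewrite (_ : _ \o _ = (fun x => k%:E * (EFin \o (fun x => (f x - m)%R)) x)%E).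
    by apply: integrableZl.
  by apply/funext.
have icst : mu.-integrable A (EFin \o cst (`|m - c| `^ p)) by exact: integrable_cst_lty.
apply: (@le_trans _ _ (\int[mu]_(x in A) (`|m - c| `^ p + k * (f x - m)))).
  rewrite RintegralD// Rintegral_cst// RintegralZl// Rintegral_subr//.
  have ms : m * s = \int[mu]_(x in A) f x by rewrite divfK// gt_eqF.
  have fs : fine (mu A) = s by rewrite muA.
  rewrite [X in k * (_ - m * X)]fs ms subrr mulr0 addr0 [s * _]mulrC.
  by apply: le_of_eq; congr (_ * _); exact: esym fs.
apply: le_Rintegral => //.
  rewrite (_ : _ \o _ =
    (EFin \o cst (`|m - c| `^ p)%R) \+ (EFin \o (fun x => (k * (f x - m))%R)))%E.
    exact: integrableD.
  by apply/funext.
move=> x _; have := powR_tangent p1 (f x - c) (m - c).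
by rewrite -/k (_ : f x - c - (m - c) = f x - m)//; ring.
Qed.

Variables (a b : R) (phi : R -> R) (rho : R).
Hypotheses (ab : a < b) (rho01 : 0 < rho < 1).
Hypothesis iphi : mu.-integrable `]a, b[ (EFin \o phi).

Let rho0 : 0 < rho. Proof. by case/andP: rho01. Qed.
Let rho1 : rho < 1. Proof. by case/andP: rho01. Qed.
Let L := b - a.
Let L0 : 0 < L. Proof. by rewrite subr_gt0. Qed.

(* [D n] is a set of measure [rho ^+ n * L] on which [phi] is largest; ties are
   broken arbitrarily. *)
Definition top_seq (D : nat -> set R) (th : nat -> R) :=
  [/\ D 0%N = `]a, b[%classic, forall n, measurable (D n),
      forall n, mu (D n) = (rho ^+ n * L)%:E,
      forall n, D n.+1 `<=` D n &
      forall n, (forall x, D n.+1 x -> th n <= phi x) /\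
                (forall x, (D n `\` D n.+1) x -> phi x <= th n)].

Lemma top_seq_exists : exists D th, top_seq D th.
Proof.
pose P n (D : set R) := [/\ measurable D, D `<=` `]a, b[ & mu D = (rho ^+ n * L)%:E].
pose Q n (D D' : set R) (th : R) := [/\ P n.+1 D', D' `<=` D,
  forall x, D' x -> th <= phi x & forall x, (D `\` D') x -> phi x <= th].
(* [choice] needs a value at every pair; where the invariant [P] fails, a dummy one is supplied. *)
have H (nD : nat * set R) : exists Dth : set R * R,
    P nD.1 nD.2 -> Q nD.1 nD.2 Dth.1 Dth.2.
  have [[mD sD muD]|nP] := pselect (P nD.1 nD.2); last by exists (set0, 0).
  have [] := @top_subset _ a b nD.2 phi (rho ^+ nD.1.+1 * L) (ltW ab) mD sD.
  - by apply: measurable_funS (integrable_measurable iphi).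
  - by rewrite mulr_gt0 ?exprn_gt0.
  - by rewrite muD lte_fin ltr_pM2r// exprS gtr_pMl ?exprn_gt0.
  - move=> D' [th [mD' sD' muD' h1 h2]]; exists (D', th) => _; split => //=.
    by split => //; exact: subset_trans sD.
have [f Hf] := choice H.
pose fix D n := if n is k.+1 then (f (k, D k)).1 else `]a, b[%classic.
have PD n : P n (D n).
  elim: n => [|n IH]; last by have [] := Hf (n, D n) IH.
  split => //=; rewrite expr0 mul1r lebesgue_measure_itv/= lte_fin ab.
  by rewrite -EFinB.
have QD n : Q n (D n) (D n.+1) (f (n, D n)).2 by exact: (Hf (n, D n)).
exists D, (fun n => (f (n, D n)).2); split => //.
- by move=> n; have [] := PD n.
- by move=> n; have [] := PD n.
- by move=> n; have [] := QD n.
- by move=> n; have [] := QD n.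
Qed.

Variables (D : nat -> set R) (th : nat -> R).
Hypothesis DP : top_seq D th.

Let mD n : measurable (D n). Proof. by have [] := DP. Qed.
Let muD n : mu (D n) = (rho ^+ n * L)%:E. Proof. by have [] := DP. Qed.
Let sDS n : D n.+1 `<=` D n. Proof. by have [] := DP. Qed.
Let Dle m n : (m <= n)%N -> D n `<=` D m.
Proof.
elim: n => [|n IH]; first by rewrite leqn0 => /eqP ->.
rewrite leq_eqVlt => /predU1P[->//|]; rewrite ltnS => /IH.
exact: subset_trans.
Qed.
Let sD n : D n `<=` `]a, b[.
Proof. by have [<- _ _ _ _] := DP; exact: Dle. Qed.
Let rhoL n : 0 < rho ^+ n * L. Proof. by rewrite mulr_gt0 ?exprn_gt0. Qed.

Definition shell n := D n `\` D n.+1.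
(** The denominators here and in [shell_avg] are the measures of [D n] and [shell n]. *)
Definition top_avg n := (\int[mu]_(x in D n) phi x) / (rho ^+ n * L).
Definition shell_avg n := (\int[mu]_(x in shell n) phi x) / ((1 - rho) * rho ^+ n * L).

Let mshell n : measurable (shell n). Proof. exact: measurableD. Qed.
Let sshell n : shell n `<=` `]a, b[. Proof. by move=> x [/sD]. Qed.
Let rhoL' n : 0 < (1 - rho) * rho ^+ n * L.
Proof. by rewrite -mulrA mulr_gt0// subr_gt0. Qed.

Lemma mu_shell n : mu (shell n) = ((1 - rho) * rho ^+ n * L)%:E.
Proof.
have DIE : D n `&` D n.+1 = D n.+1 by rewrite setIidr.
have h := measureDI mu (mD n) (mD n.+1).
rewrite DIE in h.
have := h; rewrite [X in X = _]muD [X in (_ + X)%E]muD => h'.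
have : mu (shell n) = ((rho ^+ n * L)%:E - (rho ^+ n.+1 * L)%:E)%E.
  by rewrite h' -addeA subee// adde0.
by move=> ->; rewrite -EFinB; congr EFin; rewrite exprS; ring.
Qed.

Let iphiS (A : set R) : measurable A -> A `<=` `]a, b[ -> mu.-integrable A (EFin \o phi).
Proof. by move=> mA sA; exact: integrableS iphi. Qed.

Let mu_lty (A : set R) : measurable A -> A `<=` `]a, b[ -> (mu A < +oo)%E.
Proof. exact: mu_sub_itv_lty. Qed.

Let avg_le (A : set R) (s c : R) : measurable A -> A `<=` `]a, b[ ->
  mu A = s%:E -> 0 < s ->
  (forall x, A x -> phi x <= c) -> (\int[mu]_(x in A) phi x) / s <= c.
Proof.
move=> mA sA muA s0 h; rewrite ler_pdivrMr//.
have -> : c * s = \int[mu]_(x in A) c.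
  by rewrite Rintegral_cst//; congr (_ * _); exact: (esym (congr1 fine muA)).
apply: le_Rintegral => //; first exact: iphiS.
by apply: integrable_cst_lty => //; exact: mu_lty.
Qed.

Let le_avg (A : set R) (s c : R) : measurable A -> A `<=` `]a, b[ ->
  mu A = s%:E -> 0 < s ->
  (forall x, A x -> c <= phi x) -> c <= (\int[mu]_(x in A) phi x) / s.
Proof.
move=> mA sA muA s0 h; rewrite ler_pdivlMr//.
have -> : c * s = \int[mu]_(x in A) c.
  by rewrite Rintegral_cst//; congr (_ * _); exact: (esym (congr1 fine muA)).
apply: le_Rintegral => //; last exact: iphiS.
by apply: integrable_cst_lty => //; exact: mu_lty.
Qed.

Lemma shell_avg_le n : shell_avg n <= th n.
Proof.
apply: avg_le => //; first exact: mu_shell.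
by have [_ _ _ _ /(_ n)[_]] := DP.
Qed.

Lemma le_shell_avg n : th n <= shell_avg n.+1.
Proof.
apply: le_avg => //; first exact: mu_shell.
by have [_ _ _ _ /(_ n)[h _]] := DP; move=> x [/h].
Qed.

Lemma le_top_avg n : th n <= top_avg n.+1.
Proof.
apply: le_avg => //.
by have [_ _ _ _ /(_ n)[h _]] := DP; move=> x /h.
Qed.

Lemma threshold_nd m n : (m <= n)%N -> th m <= th n.
Proof.
move=> mn; apply: (homo_leq (@lexx _ _) (@le_trans _ _)) mn => k.
exact: le_trans (le_shell_avg k) (shell_avg_le k.+1).
Qed.

(** The shell and [D n.+1] split [D n] in the proportions 1 - rho and rho. *)
Lemma top_avg_rec n : top_avg n = (1 - rho) * shell_avg n + rho * top_avg n.+1.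
Proof.
rewrite /top_avg /shell_avg (Rintegral_setID (mD n) (mD n.+1)); last exact: iphiS.
rewrite setIidr// -/(shell n) exprS.
have r0 : rho != 0 by rewrite gt_eqF.
have r1 : 1 - rho != 0 by rewrite subr_eq0 gt_eqF.
have l0 : L != 0 by rewrite gt_eqF.
have rn : rho ^+ n != 0 by rewrite expf_neq0.
by field; rewrite r0 r1 l0 rn.
Qed.

Lemma shell_avg_le_top n : shell_avg n <= top_avg n.
Proof.
rewrite top_avg_rec; have := le_trans (shell_avg_le n) (le_top_avg n) => h.
have : rho * shell_avg n <= rho * top_avg n.+1 by rewrite ler_pM2l.
lra.
Qed.

Lemma shell_avgS n : shell_avg n <= shell_avg n.+1.
Proof. exact: le_trans (shell_avg_le n) (le_shell_avg n). Qed.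

(** [top_avg_rec] unrolled [I] times; this is the hypothesis of [geometric_growth] on the means. *)
Lemma top_avg_weighted_mean I j :
  weighted_mean I.+1 (geo_weight rho I)
    (fun i => if (i < I)%N then shell_avg (j + i)%N else top_avg (j + I)%N) =
  top_avg j.
Proof.
rewrite /weighted_mean big_ord_recr/= {2}/geo_weight ltnn.
under eq_bigr => i _ do rewrite /geo_weight ltn_ord.
elim: I => [|I IH]; first by rewrite big_ord0 add0r expr0 mul1r addn0.
rewrite big_ord_recr/= -[RHS]IH -addrA; congr (_ + _).
by rewrite addnS (top_avg_rec (j + I)) exprS; ring.
Qed.

Variables (p e : R).
Hypotheses (p_gt1 : 1 < p) (e0 : 0 <= e).

(** Jensen's inequality on each of the [I] outer shells of [D j] and on the remaining set
    [D (j + I)], peeling off one shell at a time. *)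
Lemma top_jensen I j (c : R) :
  ((\sum_(i < I) (1 - rho) * rho ^+ (j + i) * L * `|shell_avg (j + i)%N - c| `^ p +
     rho ^+ (j + I) * L * `|top_avg (j + I)%N - c| `^ p)%:E <=
   \int[mu]_(x in D j) (`|phi x - c| `^ p)%:E)%E.
Proof.
elim: I j => [|I IH] j.
  rewrite big_ord0 add0r addn0; apply: avg_jensen => //.
  exact: iphiS.
rewrite big_ord_recl/= addn0 -addrA EFinD.
rewrite (@integral_setID _ (D j) (D j.+1))//; last first.
  apply/measurable_EFinP; apply: measurable_powR_osc.
  by apply: integrable_measurable; exact: iphiS.
rewrite setIidr// addeC leeD//.
  rewrite addnS -addSn; apply: le_trans (IH j.+1); rewrite lee_fin lerD2r.
  by apply: ler_sum => i _; rewrite /bump/= add1n addSn addnS.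
apply: avg_jensen => //; first exact: mu_shell.
exact: iphiS.
Qed.

Hypothesis osc_phi : forall al be : R, al < be -> `]al, be[ `<=` `]a, b[ ->
  (\int[mu]_(x in `]al, be[)
    (`|phi x - (\int[mu]_(y in `]al, be[) phi y) / (be - al)| `^ p)%:E <=
    (e `^ p * (be - al))%:E)%E.

(** [D 0] is the interval itself, and [D j.+1] is a superlevel set of threshold [th j], to which
    [top_set_osc] applies. *)
Lemma top_osc j : (\int[mu]_(x in D j) (`|phi x - top_avg j| `^ p)%:E <=
  (e `^ p * (rho ^+ j * L))%:E)%E.
Proof.
case: j => [|j].
  have D0 : D 0%N = `]a, b[%classic by have [] := DP.
  by rewrite /top_avg D0 expr0 mul1r; exact: osc_phi.
have := @top_set_osc _ p e a b phi p_gt1 ab iphi osc_phi (D j.+1) (th j) (mD _) (@sD _).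
rewrite muD lte_fin => /(_ (rhoL _)); apply.
  by have [_ _ _ _ /(_ j)[]] := DP.
move=> x [xab nD].
(* A point off [D j.+1] leaves the sequence at some [k <= j], where phi is at most [th k], hence at
   most [th j]. *)
have [k kj [Dk nDk]] : exists2 k, (k <= j)%N & D k x /\ ~ D k.+1 x.
  elim: j nD => [nD|j IH nD].
    by exists 0%N => //; split => //; have [-> _ _ _ _] := DP.
  have [Dj|nDj] := pselect (D j.+1 x); first by exists j.+1.
  by have [k kj h] := IH nDj; exists k => //; exact: leqW.
apply: le_trans (threshold_nd kj).
by have [_ _ _ _ /(_ k)[_]] := DP; apply.
Qed.

(** Dividing [top_jensen] by the measure of [D j] leaves weights independent of [j]. *)
Lemma top_weighted_osc I j :
  weighted_osc p I.+1 (geo_weight rho I)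
    (fun i => if (i < I)%N then shell_avg (j + i)%N else top_avg (j + I)%N) <= e `^ p.
Proof.
rewrite /weighted_osc top_avg_weighted_mean big_ord_recr/= {2}/geo_weight ltnn.
under eq_bigr => i _ do rewrite /geo_weight ltn_ord.
have := le_trans (top_jensen I j (top_avg j)) (top_osc j).
rewrite lee_fin => h.
rewrite -(ler_pM2r (rhoL j)); apply: le_trans h.
rewrite mulrDl mulr_suml lerD//.
  by apply: ler_sum => i _; rewrite exprD; apply: le_of_eq; ring.
by rewrite exprD; apply: le_of_eq; ring.
Qed.

(** [geometric_growth] bounds the average on shell [K] minus that on shell [I]. The latter is at
    most [top_avg I], whose distance to [top_avg 0] is controlled by the last term alone, of weight
    rho^I, of the oscillation at scale 0. *)
Lemma shell_avg_bound I K : 0 < geo_osc p rho I ->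
  shell_avg K <= top_avg 0 + e * (rho ^+ I) `^ (- p^-1) +
    K%:R * (e / geo_osc p rho I `^ p^-1).
Proof.
move=> N0; have p0 : 0 < p by exact: lt_trans p_gt1.
have NP : 0 < geo_osc p rho I `^ p^-1 by rewrite powR_gt0.
have := geometric_growth p_gt1 rho01 e0 shell_avgS shell_avg_le_top
  (top_avg_weighted_mean I) (top_weighted_osc I) K.
rewrite -ler_pdivlMr// => h1.
suff : shell_avg I <= top_avg 0 + e * (rho ^+ I) `^ (- p^-1) by lra.
have h2 := top_weighted_osc I 0.
have : rho ^+ I * `|top_avg I - top_avg 0| `^ p <= e `^ p.
  apply: le_trans h2; rewrite /weighted_osc top_avg_weighted_mean.
  rewrite big_ord_recr/= ltnn {2}/geo_weight ltnn.
  by rewrite lerDr sumr_ge0// => i _; rewrite mulr_ge0 ?geo_weight_ge0 ?powR_ge0.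
have rI : 0 < rho ^+ I by rewrite exprn_gt0.
rewrite mulrC -ler_pdivlMr// => h.
have {h} : (`|top_avg I - top_avg 0| `^ p) `^ p^-1 <= (e `^ p / rho ^+ I) `^ p^-1.
  apply: ge0_ler_powR; rewrite ?nnegrE ?powR_ge0 ?invr_ge0 ?(ltW p0)//.
  by rewrite divr_ge0 ?powR_ge0 ?ltW.
rewrite powRM ?powR_ge0 ?invr_ge0 ?(ltW rI)// -!powRrM divff ?gt_eqF//.
rewrite !powRr1// -powR_inv1 ?(ltW rI)// -powRrM mulN1r => h.
have := shell_avg_le_top I; have := ler_norm (top_avg I - top_avg 0); lra.
Qed.

End top_sequence.

(** * Exponential integrability *)

Section exp_bound.
Context {R : realType}.
Notation mu := (@lebesgue_measure R).

Lemma geometric_nneseries_le (c r : R) : 0 <= c -> 0 <= r < 1 ->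
  (\sum_(0 <= n <oo) (c * r ^+ n)%:E <= (c / (1 - r))%:E)%E.
Proof.
move=> c0 /andP[r0 r1]; apply: lime_le.
  by apply: is_cvg_nneseries => n _ _; rewrite lee_fin mulr_ge0 ?exprn_ge0.
apply: nearW => n; rewrite sumEFin lee_fin -mulr_sumr ler_wpM2l// big_mkord.
rewrite -[leRHS]mul1r ler_pdivlMr ?subr_gt0//.
have <- : 1 - r ^+ n = (\sum_(i < n) r ^+ i) * (1 - r).
  by rewrite -[LHS]opprB subrX1; ring.
by rewrite gerBl exprn_ge0.
Qed.

(** The shells fill the interval up to a null set. On shell n, phi is at most a constant plus n k,
    and the measure of the shell is proportional to rho^n, so the integral is bounded by a geometric
    series of ratio [rho * expR k]. *)
Lemma exp_integral_bound (a b : R) (phi : R -> R) (rho p e : R) (I : nat) :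
  a < b -> 0 < rho < 1 -> mu.-integrable `]a, b[ (EFin \o phi) -> 1 < p -> 0 <= e ->
  (forall al be : R, al < be -> `]al, be[ `<=` `]a, b[ ->
    (\int[mu]_(x in `]al, be[)
    (`|phi x - (\int[mu]_(y in `]al, be[) phi y) / (be - al)| `^ p)%:E <=
    (e `^ p * (be - al))%:E)%E) ->
  0 < geo_osc p rho I ->
  let k := e / geo_osc p rho I `^ p^-1 in
  rho * expR k < 1 ->
  (\int[mu]_(x in `]a, b[) (expR (phi x))%:E <=
   ((b - a) * ((1 - rho) * expR (e * (rho ^+ I) `^ (- p^-1) + k) / (1 - rho * expR k)) *
     expR ((\int[mu]_(x in `]a, b[) phi x) / (b - a)))%:E)%E.
Proof.
move=> ab rho01 iphi p1 e0 osc N0 k k1.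
have /andP[rho0 rho1] := rho01.
have [D [th DP]] := top_seq_exists ab rho01 iphi.
have [D0 mD muD sDS thP] := DP.
have L0 : 0 < b - a by rewrite subr_gt0.
pose A n := shell D n.
have mA n : measurable (A n) by exact: measurableD.
have Dle m n : (m <= n)%N -> D n `<=` D m.
  elim: n => [|n IH]; first by rewrite leqn0 => /eqP ->.
  rewrite leq_eqVlt => /predU1P[->//|]; rewrite ltnS => /IH.
  exact: subset_trans.
have mphi : measurable_fun `]a, b[ phi by exact: integrable_measurable.
have mexp : measurable_fun `]a, b[ (fun x => (expR (phi x))%:E).
  by apply/measurable_EFinP; apply: measurableT_comp.
have tA : trivIset setT A.
  apply/trivIsetP => i j _ _.
  wlog ij : i j / (i < j)%N.
    move=> h; case: (ltngtP i j) => // [ij|ji] _; first by apply: h; rewrite ?ltn_eqF.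
    by rewrite setIC; apply: h; rewrite ?ltn_eqF.
  move=> _; apply/seteqP; split => // x [[_ nD] [Dj _]]; apply: nD.
  exact: Dle ij _ Dj.
pose B := \bigcup_n A n.
have mB : measurable B by exact: bigcupT_measurable.
have sB : B `<=` `]a, b[ by move=> x [n _ [Dx _]]; rewrite -D0; exact: Dle Dx.
have capD : `]a, b[ `\` B = \bigcap_n D n.
  apply/seteqP; split => [x [xab nB] n _|x h].
    elim: n => [|n IH]; first by rewrite D0.
    by apply: contrapT => nD; apply: nB; exists n.
  split; first by rewrite -D0; exact: h.
  by move=> [n _ [_]]; apply; exact: h.
have null : mu (`]a, b[ `\` B) = 0%E.
  have cv : rho ^+ n * (b - a) @[n --> \oo] --> (0 : R).
    rewrite -[X in _ --> X](mul0r (b - a)); apply: cvgMl.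
    by apply: cvg_expr; rewrite ger0_norm// ltW.
  have mcap : measurable (\bigcap_n D n) by exact: bigcapT_measurable.
  have le n : (mu (\bigcap_n D n) <= (rho ^+ n * (b - a))%:E)%E.
    rewrite -muD; apply: le_measure; rewrite ?inE; [exact: mcap|exact: mD|].
    by move=> x; apply.
  have fin : mu (\bigcap_n D n) \is a fin_num.
    by rewrite ge0_fin_numE// (le_lt_trans (le 0%N))// ltry.
  rewrite capD -(fineK fin); congr EFin; apply/eqP; rewrite eq_le fine_ge0// andbT.
  rewrite -(cvg_lim _ cv)//; apply: limr_ge; first by apply/cvg_ex; exists 0.
  by apply: nearW => n; rewrite -lee_fin fineK.
have -> : (\int[mu]_(x in `]a, b[) (expR (phi x))%:E =
    \int[mu]_(x in B) (expR (phi x))%:E)%E.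
  rewrite (@integral_setID _ `]a, b[%classic B)//; last exact/measurable_EFinP.
  rewrite setIidr// [X in (_ + X)%E]null_set_integral ?adde0//.
  - exact: measurableD.
  - apply: measurable_funS mexp => //; exact: subDsetl.
rewrite ge0_integral_bigcup//; last exact: measurable_funS mexp.
set m0 := _ / (b - a).
have m0E : m0 = top_avg a b phi rho D 0 by rewrite /top_avg D0 expr0 mul1r.
set M := e * _.
pose c := (1 - rho) * (b - a) * expR (m0 + M + k).
apply: (@le_trans _ _ (\sum_(0 <= n <oo) (c * (rho * expR k) ^+ n)%:E)%E); last first.
  apply: le_trans (geometric_nneseries_le _ _) _.
  - by rewrite !mulr_ge0 ?expR_ge0 ?subr_ge0 ?ltW.
  - by rewrite k1 mulr_ge0 ?expR_ge0// ltW.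
  - rewrite lee_fin /c -addrA expRD; apply: le_of_eq.
    by ring.
apply: lee_nneseries => [n _ _|n _].
  by apply: integral_ge0 => x _; rewrite lee_fin expR_ge0.
(* The supremum of phi on shell n is controlled by its average on the next shell, whence the index
   [n.+1]. *)
have thb : th n <= m0 + M + n.+1%:R * k.
  apply: le_trans (le_shell_avg ab rho01 iphi DP n) _.
  by rewrite m0E; exact: (shell_avg_bound ab rho01 iphi DP p1 e0 osc n.+1 N0).
apply: (@le_trans _ _ (\int[mu]_(x in A n) (expR (m0 + M + n.+1%:R * k))%:E)%E).
  apply: ge0_le_integral => //.
  - exact: mA.
  - apply: measurable_funS mexp => //; apply: subset_trans sB; exact: bigcup_sup.
  - move=> x Ax; rewrite lee_fin ler_expR; apply: le_trans thb.
    by have [_] := thP n; apply.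
rewrite integral_cst; last exact: mA.
rewrite [X in (_ * X)%E](mu_shell DP n) -EFinM lee_fin; apply: le_of_eq.
rewrite /c exprMn -expRM_natl -natr1 mulrDl mul1r addrA addrAC expRD.
by ring.
Qed.
End exp_bound.

(** * A lower bound for the John-Nirenberg constant *)

Section averages.
Context {R : realType}.
Notation mu := (@lebesgue_measure R).
Implicit Types (J Q : set R) (phi f : R -> R).

Definition len J : R := fine (mu J).

Lemma finite_interval_measurable J : finite_interval J -> measurable J.
Proof. by move=> [/is_interval_measurable]. Qed.

Lemma finite_interval_len J : finite_interval J -> mu J = (len J)%:E.
Proof. by move=> [_ /andP[J0 Joo]]; rewrite fineK// ge0_fin_numE// ltW. Qed.

Lemma len_gt0 J : finite_interval J -> 0 < len J.
Proof. by move=> fJ; have [_ /andP[+ _]] := fJ; rewrite finite_interval_len. Qed.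

Lemma eavgE J f : finite_interval J ->
  eavg J f = ((len J)^-1%:E * \int[mu]_(x in J) (f x)%:E)%E.
Proof.
move=> fJ; rewrite /eavg finite_interval_len// inver gt_eqF//.
exact: len_gt0.
Qed.

Lemma eavg_le J f (c : R) : finite_interval J ->
  (eavg J f <= c%:E)%E = (\int[mu]_(x in J) (f x)%:E <= (c * len J)%:E)%E.
Proof.
by move=> fJ; rewrite eavgE// lee_pdivrMl ?len_gt0// -EFinM mulrC.
Qed.

Lemma avgE J f : finite_interval J -> mu.-integrable J (EFin \o f) ->
  avg J f = (\int[mu]_(x in J) f x) / len J.
Proof.
move=> fJ intf; rewrite /avg eavgE// EFin_Rintegral//; last first.
  exact: finite_interval_measurable.
by rewrite -EFinM/= mulrC.
Qed.

(** Taking powers p and 1/p is monotone on [0, +oo], so the root, the division by the length and the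
    supremum can be removed. *)
Lemma bmo_norm_leP (p e : R) Q phi : 0 < p -> 0 <= e ->
  (bmo_norm p Q phi <= e%:E)%E <-> forall J, subinterval Q J ->
  (\int[mu]_(x in J) (`|phi x - avg J phi| `^ p)%:E <= (e `^ p * len J)%:E)%E.
Proof.
move=> p0 e0; have pp : p^-1 * p = 1 by rewrite mulVf// gt_eqF.
have avg0 J : (0 <= eavg J (fun x => `|phi x - avg J phi| `^ p)%R)%E.
  by rewrite mule_ge0 ?inve_ge0// integral_ge0// => x _; rewrite lee_fin powR_ge0.
split=> [h J QJ|h].
  rewrite -eavg_le; last by case: QJ.
  have : (eavg J (fun x => (`|phi x - avg J phi| `^ p)%R) `^ p^-1 <= e%:E)%E.
    by apply: le_trans h; apply: ereal_sup_ubound; exists J.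
  move=> /(gt0_ler_poweR (ltW p0)); rewrite -poweRrM pp poweRe1// poweR_EFin.
  by apply; rewrite in_itv/= ?andbT ?leey ?poweR_ge0 ?lee_fin// e0.
apply: ge_ereal_sup => _ [J QJ <-].
have := h J QJ; rewrite -eavg_le; last by case: QJ.
have pV0 : 0 <= p^-1 by rewrite invr_ge0 ltW.
move=> /(gt0_ler_poweR pV0).
rewrite poweR_EFin -powRrM mulfV ?gt_eqF// powRr1//.
by apply; rewrite in_itv/= ?andbT ?leey ?avg0// lee_fin powR_ge0.
Qed.

Lemma finite_interval_itv J : finite_interval J ->
  exists a b b0 b1, a < b /\ J = [set` Interval (BSide b0 a) (BSide b1 b)].
Proof.
move=> [/is_intervalP JE /andP[]]; rewrite JE.
case: (Rhull J) => -[b0 a|[]] [b1 b|[]];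
  rewrite lebesgue_measure_itv/= ?ltxx ?ltry ?ltNyr//=.
case: ifPn => [|_]; last by rewrite ltxx.
rewrite lte_fin => ab _ _.
by exists a, b, b0, b1.
Qed.

Lemma finite_interval_ooitv (a b : R) : a < b -> finite_interval `]a, b[.
Proof.
move=> ab; split; first exact: interval_is_interval.
by rewrite lebesgue_measure_itv/= lte_fin ab -EFinB lte_fin subr_gt0 ab ltry.
Qed.

(** For k = e / N^(1/p), the condition e < (- ln rho) N^(1/p) says exactly that [rho * expR k < 1].
    The constant of [exp_integral_bound] then depends only on e, p, rho and I. Endpoints of [J] are
    null, so open intervals suffice. *)
Lemma JN_property_geo (p rho : R) (I : nat) : 1 < p -> 0 < rho < 1 ->
  JN_property p (- ln rho * geo_osc p rho I `^ p^-1).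
Proof.
move=> p1 rho01 e /andP[e0 eN]; have /andP[rho0 rho1] := rho01.
have p0 : 0 < p by exact: lt_trans p1.
(* If the oscillation were 0, no e >= 0 would satisfy the strict bound. *)
have N0 : 0 < geo_osc p rho I.
  rewrite lt_neqAle geo_osc_ge0// andbT eq_sym; apply: contraTneq eN => ->.
  by rewrite powR0 ?invr_eq0 ?gt_eqF// mulr0 -leNgt.
have NP : 0 < geo_osc p rho I `^ p^-1 by rewrite powR_gt0.
set k := e / geo_osc p rho I `^ p^-1.
have k1 : rho * expR k < 1.
  rewrite -ltr_pdivlMl// mulr1 -(lnK (x := rho^-1)); last by rewrite posrE invr_gt0.
  by rewrite ltr_expR lnV ?posrE// ltr_pdivrMr.
exists ((1 - rho) * expR (e * (rho ^+ I) `^ (- p^-1) + k) / (1 - rho * expR k)).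
  by rewrite divr_gt0 ?subr_gt0// mulr_gt0 ?expR_gt0// subr_gt0.
move=> Q phi fQ [iphi _] norm_phi J [fJ JQ].
have iphiJ : mu.-integrable J (EFin \o phi).
  by apply: integrableS iphi => //; exact: finite_interval_measurable.
have [a [b [b0 [b1 [ab JE]]]]] := finite_interval_itv fJ.
have sJ : `]a, b[ `<=` J.
  by rewrite JE => x /=; rewrite !in_itv/= => /andP[ax xb]; rewrite !lteifS.
have iphiab : mu.-integrable `]a, b[ (EFin \o phi).
  by apply: integrableS iphiJ => //; exact: finite_interval_measurable.
have lenJ : len J = b - a by rewrite /len JE fine_mu_itv// ltW.
have osc al be : al < be -> `]al, be[ `<=` `]a, b[ ->
    (\int[mu]_(x in `]al, be[)
    (`|phi x - (\int[mu]_(y in `]al, be[) phi y) / (be - al)| `^ p)%:E <=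
    (e `^ p * (be - al))%:E)%E.
  move=> albe sub.
  have QI : subinterval Q `]al, be[.
    split; first exact: finite_interval_ooitv.
    exact: subset_trans (subset_trans sub sJ) JQ.
  have := (bmo_norm_leP Q phi p0 e0).1 norm_phi _ QI.
  rewrite avgE; last 2 first.
  - exact: finite_interval_ooitv.
  - exact: integrableS iphiab.
  by rewrite /len fine_mu_itv// ltW.
rewrite eavg_le// avgE// lenJ.
have mphi := integrable_measurable iphiab.
have := exp_integral_bound ab rho01 iphiab p1 e0 osc N0 k1.
have -> : (\int[mu]_(x in J) ((expR \o phi) x)%:E =
    \int[mu]_(x in `]a, b[) (expR (phi x))%:E)%E.
  rewrite JE integral_itv_bndoo//.
  by apply/measurable_EFinP; apply: measurableT_comp.
have -> : \int[mu]_(x in J) phi x = \int[mu]_(x in `]a, b[) phi x.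
  by rewrite /Rintegral JE integral_itv_bndoo//; exact/measurable_EFinP.
move=> /le_trans; apply; rewrite lee_fin -/k; apply: le_of_eq.
set C := (_ / (1 - rho * expR k)); ring.
Qed.
End averages.

(** * The oscillation of the logarithm *)

Section log_steps.
Context {R : realType}.
Notation mu := (@lebesgue_measure R).
Variables (a b rho : R) (I : nat).
Hypotheses (a0 : 0 <= a) (ab : a < b) (b1 : b <= 1) (rho01 : 0 < rho < 1).

Let rho0 : 0 < rho. Proof. by case/andP: rho01. Qed.
Let rho1 : rho < 1. Proof. by case/andP: rho01. Qed.
Let ba0 : 0 < b - a. Proof. by rewrite subr_gt0. Qed.

(** The nodes decrease geometrically to [a], so that the pieces they cut from ]a, b] have relative
    measures [geo_weight]. *)
Definition node i : R := a + (b - a) * rho ^+ i.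
Definition level i : R := - ln (node i).
(** On the i-th piece this is the value of - ln at the right endpoint, its minimum there. Writing it
    as a sum of jumps makes it a combination of indicators, hence measurable. *)
Definition log_step (x : R) : R :=
  level 0 + \sum_(k < I) (level k.+1 - level k) * (x <= node k.+1)%R%:R.

Lemma node0 : node 0 = b.
Proof. by rewrite /node expr0 mulr1 addrC subrK. Qed.

Lemma node_gt i : a < node i.
Proof. by rewrite ltrDl mulr_gt0 ?exprn_gt0. Qed.

Lemma node_gt0 i : 0 < node i.
Proof. exact: le_lt_trans (node_gt i). Qed.

Lemma node_le i j : (i <= j)%N -> node j <= node i.
Proof.
by move=> ij; rewrite lerD2l ler_pM2l// ler_wiXn2l// ltW.
Qed.

Lemma node_lt i : node i.+1 < node i.
Proof. by rewrite ltrD2l ltr_pM2l// exprS gtr_pMl// exprn_gt0. Qed.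

Lemma level_nd i j : (i <= j)%N -> level i <= level j.
Proof. by move=> ij; rewrite lerN2 ler_ln ?posrE ?node_gt0// node_le. Qed.

Lemma level_ge0 i : 0 <= level i.
Proof.
by rewrite oppr_ge0 ln_le0// (le_trans _ b1)// -node0 node_le.
Qed.

(** Since a >= 0, [node i.+1] is at least [rho * node i], with equality when a = 0. *)
Lemma levelS i : level i.+1 - level i <= - ln rho.
Proof.
rewrite /level opprK addrC -ln_div ?posrE ?node_gt0// -lnV ?posrE//.
rewrite ler_ln ?posrE ?divr_gt0 ?invr_gt0 ?node_gt0//.
rewrite ler_pdivrMr ?node_gt0// ler_pdivlMl// /node exprS mulrDr mulrCA lerD2r.
by rewrite ler_piMl// ltW.
Qed.

Lemma log_step_bulk i x : (i < I)%N -> node i.+1 < x <= node i -> log_step x = level i.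
Proof.
move=> iI /andP[x1 x2]; rewrite /log_step.
have -> : \sum_(k < I) (level k.+1 - level k) * (x <= node k.+1)%R%:R =
    \sum_(0 <= k < I) (if (k < i)%N then level k.+1 - level k else 0).
  rewrite big_mkord; apply: eq_bigr => k _; case: ltnP => ki.
    by rewrite (le_trans x2) ?mulr1// node_le.
  by rewrite leNgt (le_lt_trans _ x1) ?mulr0// node_le.
rewrite (big_cat_nat (n := i))//=; last exact: ltnW.
rewrite [X in _ + (_ + X)]big_nat_cond [X in _ + (_ + X)]big1 ?addr0; last first.
  by move=> k /andP[/andP[ik _] _]; rewrite ltnNge ik.
rewrite big_nat_cond (eq_bigr (fun k => level k.+1 - level k)); last first.
  by move=> k /andP[/andP[_ ->]].
by rewrite -big_nat_cond telescope_sumr// addrC subrK.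
Qed.

Lemma log_step_tail x : x <= node I -> log_step x = level I.
Proof.
move=> xI; rewrite /log_step.
rewrite (eq_bigr (fun k : 'I_I => level k.+1 - level k)); last first.
  by move=> k _; rewrite (le_trans xI) ?mulr1// node_le.
rewrite -(big_mkord xpredT (fun k => level k.+1 - level k)).
by rewrite telescope_sumr// addrC subrK.
Qed.

Lemma measurable_log_step : measurable_fun setT log_step.
Proof.
apply: measurable_funD => //; apply: measurable_sum => k.
apply: measurable_funM => //.
rewrite (_ : (fun x => _) = \1_(`]-oo, node k.+1]%classic : set R)).
  exact: measurable_indic.
by apply/funext => x; rewrite indicE mem_setE in_itv.
Qed.

Lemma node_bracket x : node I < x <= b ->
  exists2 i, (i < I)%N & node i.+1 < x <= node i.
Proof.
elim: I => [|n IH]; first by rewrite node0 => /andP[] /lt_le_trans h /h; rewrite ltxx.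
move=> /andP[x1 x2]; have [xn|nx] := leP x (node n).
  by exists n => //; rewrite x1.
have [|i iI h] := IH; first by rewrite nx.
by exists i => //; exact: ltnW.
Qed.

Lemma log_step_le x : a < x <= b -> 0 <= log_step x <= - ln x.
Proof.
move=> /andP[ax xb]; have x0 : 0 < x by exact: le_lt_trans ax.
have [xI|Ix] := leP x (node I).
  rewrite log_step_tail// level_ge0/= lerN2.
  by rewrite ler_ln ?posrE ?node_gt0.
have [|i iI ix] := @node_bracket x; first by rewrite Ix.
rewrite (log_step_bulk iI ix) level_ge0/= lerN2 ler_ln ?posrE ?node_gt0//.
by have /andP[] := ix.
Qed.

Lemma log_step_near x : node I < x <= b -> - ln x - log_step x <= - ln rho.
Proof.
move=> Ixb; have [i iI ix] := node_bracket Ixb.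
have /andP[x1 x2] := ix.
have x0 : 0 < x by exact: lt_trans (node_gt0 _) x1.
rewrite (log_step_bulk iI ix); apply: (le_trans _ (levelS i)).
by rewrite lerD2r lerN2 ler_ln ?posrE ?node_gt0// ltW.
Qed.

Lemma integral_nodes (f : R -> R) : measurable_fun setT f ->
  (\int[mu]_(x in `]a, b]) (f x)%:E =
   \sum_(i < I) \int[mu]_(x in `]node i.+1, node i]) (f x)%:E +
   \int[mu]_(x in `]a, node I]) (f x)%:E)%E.
Proof.
move=> mf; elim: I => [|n IH]; first by rewrite big_ord0 add0e node0.
rewrite big_ord_recr/= IH -addeA; congr (_ + _)%E.
rewrite (@itv_bndbnd_setU _ _ _ (BRight (node n.+1))) ?bnd_simp
  ?(ltW (node_gt _)) ?(ltW (node_lt _))//.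
rewrite integral_setU//; first by rewrite addeC.
  by apply/measurable_EFinP; exact: measurable_funTS.
rewrite disj_set2E; apply/eqP/seteqP; split => // x [/=]; rewrite !in_itv/=.
by move=> /andP[_ h1] /andP[h2 _]; move: (lt_le_trans h2 h1); rewrite ltxx.
Qed.

Lemma integral_log_step (G : R -> R) : measurable_fun setT G ->
  (\int[mu]_(x in `]a, b]) (G (log_step x))%:E =
   ((b - a) * \sum_(i < I.+1) geo_weight rho I i * G (level i))%:E)%E.
Proof.
move=> mG.
have mGl : measurable_fun setT (fun x => G (log_step x)).
  by apply: measurableT_comp => //; exact: measurable_log_step.
rewrite integral_nodes// big_ord_recr/= {2}/geo_weight ltnn mulrDr EFinD; congr (_ + _)%E.
  rewrite mulr_sumr -sumEFin; apply: eq_bigr => i _.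
  rewrite (_ : (\int[mu]_(x in _) _)%E =
      \int[mu]_(x in `]node i.+1, node i]) (G (level i))%:E)%E.
    rewrite integral_cst//= lebesgue_measure_itv/= lte_fin node_lt -EFinD -EFinM.
    by congr EFin; rewrite /geo_weight ltn_ord /node exprS; ring.
  apply: eq_integral => x; rewrite inE/= in_itv/= => h.
  by rewrite (log_step_bulk (ltn_ord i) h).
rewrite (_ : (\int[mu]_(x in _) _)%E = \int[mu]_(x in `]a, node I]) (G (level I))%:E)%E.
  rewrite integral_cst//= lebesgue_measure_itv/= lte_fin node_gt -EFinD -EFinM.
  by congr EFin; rewrite /node; ring.
apply: eq_integral => x; rewrite inE/= in_itv/= => /andP[_ h].
by rewrite log_step_tail.
Qed.

(** By [levelS] the levels increase no faster than the linear sequence of slope - ln rho, so they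
    oscillate less. *)
Lemma level_weighted_osc (p : R) : 1 < p ->
  weighted_osc p I.+1 (geo_weight rho I) level <=
  (- ln rho * geo_osc p rho I `^ p^-1) `^ p.
Proof.
move=> p1; have p0 : 0 < p by exact: lt_trans p1.
have h0 : 0 <= - ln rho by rewrite oppr_ge0 ln_le0// ltW.
rewrite powRM ?powR_ge0// -powRrM mulVf ?gt_eqF// powRr1 ?geo_osc_ge0//.
rewrite -weighted_osc_scale//; apply: weighted_osc_comonotone => //.
- by move=> i; exact: geo_weight_ge0.
- exact: geo_weight_sum.
- by move=> i j /andP[ij _]; exact: level_nd.
- move=> i j /andP[ij _]; elim: j ij => [|j IH]; first by rewrite leqn0 => /eqP ->.
  rewrite leq_eqVlt => /predU1P[->//|]; rewrite ltnS => /IH /le_trans; apply.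
  have := levelS j; rewrite -natr1; lra.
Qed.

Lemma log_step_osc (p c : R) : 1 < p -> 0 <= c ->
  - ln rho * geo_osc p rho I `^ p^-1 <= c ->
  (\int[mu]_(x in `]a, b])
     (`|log_step x - (\int[mu]_(y in `]a, b]) log_step y) / (b - a)| `^ p)%:E <=
   (c `^ p * (b - a))%:E)%E.
Proof.
move=> p1 c0 hc; have p0 : 0 < p by exact: lt_trans p1.
have -> : (\int[mu]_(y in `]a, b]) log_step y) / (b - a) =
    weighted_mean I.+1 (geo_weight rho I) level.
  by rewrite /Rintegral (integral_log_step (G := id))//= mulrC mulKf ?gt_eqF.
rewrite (integral_log_step (G := fun y => `|y - _| `^ p)); last first.
  apply: (measurableT_comp (measurable_powR _)) => //.
  by apply: measurableT_comp => //; exact: measurable_funB.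
rewrite lee_fin mulrC ler_pM2r//; apply: le_trans (level_weighted_osc p1) _.
have h0 : 0 <= - ln rho by rewrite oppr_ge0 ln_le0// ltW.
apply: ge0_ler_powR; rewrite ?nnegrE ?(ltW p0)//.
by rewrite mulr_ge0 ?powR_ge0.
Qed.

End log_steps.

(** * Passage from step functions to the logarithm *)

Section log_osc.
Context {R : realType}.
Notation mu := (@lebesgue_measure R).

Lemma fatou_le (D : set R) (f : nat -> R -> R) (g : R -> R) (C : R) : measurable D ->
  (forall n, measurable_fun D (f n)) -> (forall n x, D x -> 0 <= f n x) ->
  (forall x, D x -> f n x @[n --> \oo] --> g x) ->
  (forall n, \int[mu]_(x in D) (f n x)%:E <= C%:E)%E ->
  (\int[mu]_(x in D) (g x)%:E <= C%:E)%E.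
Proof.
move=> mD mf f0 fg fC.
have -> : (\int[mu]_(x in D) (g x)%:E =
    \int[mu]_(x in D) limn_einf (fun n => (f n x)%:E))%E.
  apply: eq_integral => x; rewrite inE => Dx.
  have h : (f n x)%:E @[n --> \oo] --> (g x)%:E.
    by apply: cvg_EFin; [exact: nearW|exact: fg].
  by rewrite (cvg_limn_einf_sup h).1.
apply: le_trans (@fatou _ _ _ mu D mD (fun n x => (f n x)%:E) _ _) _.
- by move=> n; apply/measurable_EFinP; exact: mf.
- by move=> n x Dx; rewrite lee_fin; exact: f0.
rewrite limn_einf_lim; apply: lime_le; first exact: is_cvg_einfs.
apply: nearW => n; apply: le_trans (fC n).
by apply: ereal_inf_lbound; exists n => /=.
Qed.

(* Both the increments, at most [n.+1%:R^-1], and the mass of the last piece, at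
   most [expR (- n.+1%:R)], of the step functions with these parameters tend to 0. *)
Definition step_ratio (n : nat) : R := expR (- n.+1%:R^-1).
Definition step_count (n : nat) : nat := (n.+1 * n.+1)%N.

Lemma step_ratio_itv n : 0 < step_ratio n < 1.
Proof. by rewrite expR_gt0 /step_ratio expR_lt1 oppr_lt0 invr_gt0 ltr0n. Qed.

Lemma ln_step_ratio n : - ln (step_ratio n) = n.+1%:R^-1.
Proof. by rewrite expRK opprK. Qed.

Lemma step_ratio_tail n : step_ratio n ^+ step_count n <= n.+1%:R^-1.
Proof.
have n0 : 0 < n.+1%:R :> R by rewrite ltr0n.
rewrite /step_ratio -expRM_natl /step_count natrM mulrN -mulrA divff ?gt_eqF// mulr1 expRN.
rewrite lef_pV2 ?posrE ?expR_gt0//.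
by rewrite (le_trans _ (expR_ge1Dx _))// lerDr.
Qed.

Variables (a b : R).
Hypotheses (a0 : 0 <= a) (ab : a < b) (b1 : b <= 1).

Let L n := log_step a b (step_ratio n) (step_count n).

(** The last node tends to [a]; once it is below [x], the error at [x] is at most
    [- ln (step_ratio n)]. *)
Lemma log_step_cvg x : a < x <= b -> L n x @[n --> \oo] --> - ln x.
Proof.
move=> /andP[ax xb]; apply/cvgrPdist_lt => /= e e0.
have d0 : 0 < (x - a) / (b - a) by rewrite divr_gt0 ?subr_gt0.
near=> n.
have h1 : n.+1%:R^-1 < (x - a) / (b - a).
  by near: n; exact: (near_infty_natSinv_lt (PosNum d0)).
have h2 : n.+1%:R^-1 < e.
  by near: n; exact: (near_infty_natSinv_lt (PosNum e0)).
have xn : node a b (step_ratio n) (step_count n) < x.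
  rewrite /node -ltrBrDl -ltr_pdivlMl ?subr_gt0// mulrC.
  exact: le_lt_trans (step_ratio_tail n) h1.
have axb : a < x <= b by rewrite ax.
have := log_step_le (step_count n) a0 ab b1 (step_ratio_itv n) axb => /andP[_ le].
rewrite ger0_norm ?subr_ge0//; apply: le_lt_trans h2.
rewrite -ln_step_ratio; apply: log_step_near => //; first exact: step_ratio_itv.
by rewrite xn.
Unshelve. all: by end_near. Qed.

(** The tangent inequality, used at both points, bounds the difference of the powers by p M times
    the distance, where M bounds [spow] on [- |y| - 1, |y| + 1]. *)
Lemma cvg_powR_norm (p : R) (u : nat -> R) (y : R) : 1 < p ->
  u n @[n --> \oo] --> y -> `|u n| `^ p @[n --> \oo] --> `|y| `^ p.
Proof.
move=> p1 uy; have p0 : 0 < p by exact: lt_trans p1.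
pose M := (`|y| + 1) `^ (p - 1).
have hM (z : R) : `|z| <= `|y| + 1 -> `|spow p z| <= M.
  move=> zy; rewrite /spow normrM normr_sg -[leRHS]mul1r ler_pM//.
    by case: (z != 0); rewrite ?ler01.
  rewrite ger0_norm ?powR_ge0//; apply: ge0_ler_powR => //.
  - by rewrite subr_ge0 ltW.
  - by rewrite nnegrE addr_ge0.
apply/cvgrPdist_le => /= e e0.
have M0 : 0 < M by rewrite powR_gt0// ltr_pwDr.
near=> n.
have h1 : `|y - u n| <= 1.
  by near: n; apply: (cvgrPdist_le _ _).1 uy _ _.
have h2 : `|y - u n| <= e / (p * M).
  by near: n; apply: (cvgrPdist_le _ _).1 uy _ _; rewrite divr_gt0 ?mulr_gt0.
have un : `|u n| <= `|y| + 1.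
  by have := ler_normD y (u n - y); rewrite [y + _]addrC subrK distrC; lra.
have main (z w : R) : `|z| <= `|y| + 1 -> `|z - w| <= e / (p * M) ->
    `|z| `^ p - `|w| `^ p <= e.
  move=> zM zw; have := powR_tangent p1 w z.
  have : - (p * spow p z * (w - z)) <= e.
    apply: le_trans (ler_norm _) _.
    rewrite normrN normrM [X in X * _]normrM (gtr0_norm p0) distrC.
    apply: (@le_trans _ _ (p * M * (e / (p * M)))).
      apply: ler_pM => //; first by apply: mulr_ge0 => //; exact: ltW.
      by apply: ler_wpM2l; [exact: ltW|exact: hM].
    by rewrite mulrCA divff ?mulr1// gt_eqF// mulr_gt0.
  lra.
rewrite ler_norml; apply/andP; split; last by apply: main; rewrite ?lerDl.
by rewrite lerNl opprB; apply: main => //; rewrite distrC.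
Unshelve. all: by end_near. Qed.

(** The mean of the truncated geometric distribution is rho + ... + rho^I. *)
Lemma weighted_mean_geo_weight_id (rho : R) I : rho != 1 ->
  (1 - rho) * weighted_mean I.+1 (geo_weight rho I) (fun i => i%:R) =
  rho * (1 - rho ^+ I).
Proof.
move=> r1; rewrite /weighted_mean big_ord_recr/= {2}/geo_weight ltnn.
under eq_bigr => i _ do rewrite /geo_weight ltn_ord.
elim: I => [|I IH]; first by rewrite big_ord0 expr0 mulr0 addr0 subrr !mulr0.
rewrite big_ord_recr/= exprS -natr1; move: IH.
set S := \sum_(i < I) _ => IH.
have -> : S = S + rho ^+ I * I%:R - rho ^+ I * I%:R by rewrite addrK.
set T := S + _ in IH *.
transitivity ((1 - rho) * T + (1 - rho) * rho ^+ I * rho); first by ring.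
by rewrite IH; ring.
Qed.

(** The levels grow at most linearly with slope - ln rho, and the mean index is at most rho / (1 -
    rho). As - ln rho <= (1 - rho) / rho, the product is at most 1 for every n; Fatou's lemma then
    makes the logarithm integrable. *)
Lemma integral_log_step_le n :
  (\int[mu]_(x in `]a, b]) (L n x)%:E <= ((b - a) * (level a b (step_ratio n) 0 + 1))%:E)%E.
Proof.
rewrite (integral_log_step (step_count n) ab (step_ratio_itv n) (G := id))// lee_fin.
have /andP[r0 r1] := step_ratio_itv n.
rewrite ler_pM2l ?subr_gt0//.
set w := geo_weight (step_ratio n) (step_count n).
have w0 i : 0 <= w i by apply: geo_weight_ge0; exact: step_ratio_itv.
have w1 : \sum_(i < (step_count n).+1) w i = 1 by apply: geo_weight_sum.
apply: (@le_trans _ _ (level a b (step_ratio n) 0 +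
    - ln (step_ratio n) * weighted_mean (step_count n).+1 w (fun i => i%:R))).
  have l0E : level a b (step_ratio n) 0 = \sum_(i < (step_count n).+1) w i * level a b (step_ratio n) 0.
    by rewrite -mulr_suml w1 mul1r.
  rewrite [X in _ <= X + _]l0E /weighted_mean mulr_sumr -big_split/=.
  apply: ler_sum => i _.
  have : level a b (step_ratio n) i <= level a b (step_ratio n) 0 + i%:R * - ln (step_ratio n).
    elim: (nat_of_ord i) => [|k IH]; first by rewrite mul0r addr0.
    have := levelS a0 ab (step_ratio_itv n) k; rewrite -natr1; lra.
  move=> /(ler_wpM2l (w0 i)) /le_trans; apply; rewrite -/w.
  by apply: le_of_eq; ring.
rewrite lerD2l.
have hr : - ln (step_ratio n) <= (1 - step_ratio n) / step_ratio n.
  rewrite -lnV ?posrE//; have := @le_ln1Dx R ((step_ratio n)^-1 - 1).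
  rewrite [1 + _]addrC subrK mulrBl mul1r divff ?gt_eqF//; apply.
  by rewrite ltrBrDl subrr invr_gt0.
have S0 : 0 <= weighted_mean (step_count n).+1 w (fun i => i%:R).
  by apply: sumr_ge0 => i _; rewrite mulr_ge0.
apply: (le_trans (ler_wpM2r S0 hr)).
rewrite mulrAC ler_pdivrMr// mul1r weighted_mean_geo_weight_id ?lt_eqF//.
by rewrite ler_piMr ?(ltW r0)// gerBl exprn_ge0// ltW.
Qed.

Lemma integrable_log : mu.-integrable `]a, b] (EFin \o (fun x => - ln x)).
Proof.
have mln : measurable_fun `]a, b] (fun x => - ln x : R).
  by apply: measurable_funTS; apply: measurableT_comp.
apply/integrableP; split; first exact/measurable_EFinP.
rewrite (_ : (\int[mu]_(x in _) _)%E = \int[mu]_(x in `]a, b]) (- ln x)%:E)%E.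
  apply: (@le_lt_trans _ _ ((b - a) * (- ln b + 1))%:E); last exact: ltry.
  apply: (@fatou_le _ L) => //.
  - by move=> n; apply: measurable_funTS; exact: measurable_log_step.
  - move=> n x; rewrite /= in_itv/= => h.
    by have /andP[] := log_step_le (step_count n) a0 ab b1 (step_ratio_itv n) h.
  - by move=> x; rewrite /= in_itv/=; exact: log_step_cvg.
  - by move=> n; have := integral_log_step_le n; rewrite /level node0.
apply: eq_integral => x; rewrite inE/= in_itv/= => /andP[_ xb].
by rewrite ger0_norm// oppr_ge0 ln_le0// (le_trans xb).
Qed.

(** Dominated convergence, with - ln itself as dominating function. *)
Lemma Rintegral_log_step_cvg :
  \int[mu]_(x in `]a, b]) L n x @[n --> \oo] --> \int[mu]_(x in `]a, b]) (- ln x).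
Proof.
have mL n : measurable_fun `]a, b] (L n).
  by apply: measurable_funTS; exact: measurable_log_step.
have [|||||_ _ h] := @dominated_convergence _ _ _ mu
  `]a, b]%classic (measurable_itv _) (fun n x => (L n x)%:E)
  (fun x => (- ln x)%:E) (fun x => (- ln x)%:E).
- by move=> n; apply/measurable_EFinP; exact: mL.
- by apply/measurable_EFinP; apply: measurable_funTS; apply: measurableT_comp.
- apply: aeW => x; rewrite /= in_itv/= => xab.
  by apply: cvg_EFin; [exact: nearW|exact: log_step_cvg].
- exact: integrable_log.
- apply: aeW => x n; rewrite /= in_itv/= => xab.
  have /andP[h1 h2] := log_step_le (step_count n) a0 ab b1 (step_ratio_itv n) xab.
  by rewrite lee_fin ger0_norm.
apply: fine_cvg.
rewrite fineK//; apply: integrable_fin_num => //; exact: integrable_log.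
Qed.

(** Fatou's lemma: the step functions and their averages converge, and [log_step_osc] bounds all
    their oscillations. *)
Lemma log_osc (p c : R) : 1 < p -> 0 <= c ->
  (forall rho I, 0 < rho < 1 -> - ln rho * geo_osc p rho I `^ p^-1 <= c) ->
  (\int[mu]_(x in `]a, b])
     (`|- ln x - (\int[mu]_(y in `]a, b]) (- ln y)) / (b - a)| `^ p)%:E <=
   (c `^ p * (b - a))%:E)%E.
Proof.
move=> p1 c0 hc.
pose m n := (\int[mu]_(y in `]a, b]) L n y) / (b - a).
apply: (@fatou_le _ (fun n x => `|L n x - m n| `^ p)) => //.
- move=> n; apply/measurable_EFinP; apply: measurable_powR_osc.
  by apply: measurable_funTS; exact: measurable_log_step.
- move=> x; rewrite /= in_itv/= => xab; apply: cvg_powR_norm => //.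
  apply: cvgB; first exact: log_step_cvg.
  by apply: cvgMl; exact: Rintegral_log_step_cvg.
- by move=> n; apply: log_step_osc => //; [exact: step_ratio_itv|apply: hc; exact: step_ratio_itv].
Qed.

End log_osc.

(** * Bounded perturbations *)

Section perturbation.
Context {R : realType}.
Notation mu := (@lebesgue_measure R).
Implicit Types (J Q : set R) (phi f : R -> R).

(** Selects the branch of [Lnorm] in which the norm of exponent [+oo] is an essential supremum. *)
Lemma lebesgue_setT_gt0 : (0 < mu [set: R])%E.
Proof.
apply: (@lt_le_trans _ _ (mu `]0%R, 1%R[)).
  by rewrite lebesgue_measure_itv/= lte_fin ltr01 -EFinB subr0 lte_fin.
by apply: le_measure; rewrite ?inE.
Qed.

Lemma Linfty_bounded Q f : measurable Q -> Linfty Q f ->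
  measurable_fun Q f /\ exists M, {ae mu, forall x, Q x -> `|f x| <= M}.
Proof.
move=> mQ; rewrite /Linfty inE => /andP[/[!inE]/= mf fin]; split.
  exact/(measurable_restrictT _ mQ).
move: fin; rewrite /finite_norm unlock /Lnorm lebesgue_setT_gt0.
move=> /ess_supr_bounded[M hM]; exists M; case: hM => N [mN N0 sN].
exists N; split => //; apply: subset_trans sN => x /= nh h; apply: nh => Qx.
by move: h; rewrite patchE mem_set.
Qed.

Lemma Linfty_cst0 Q : Linfty Q (cst 0).
Proof.
rewrite /Linfty (_ : _ \_ Q = cst 0); last first.
  by apply/funext => x; rewrite patchE; case: ifP.
rewrite inE; apply/andP; split; rewrite inE//=.
rewrite /finite_norm unlock /Lnorm lebesgue_setT_gt0.
rewrite (_ : abse \o _ = cst 0%E); last by apply/funext => x /=; rewrite normr0.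
by rewrite ess_sup_cst ?ltry// lebesgue_setT_gt0.
Qed.

Lemma bmo_norm_ge0 p Q phi : finite_interval Q -> (0 <= bmo_norm p Q phi)%E.
Proof.
move=> fQ; apply: (@le_trans _ _
    (eavg Q (fun x => `|phi x - avg Q phi| `^ p)%R `^ p^-1)%E).
  exact: poweR_ge0.
by apply: ereal_sup_ubound; exists Q => //; split.
Qed.

Lemma avgZ J phi k : finite_interval J -> mu.-integrable J (EFin \o phi) ->
  avg J (fun x => k * phi x) = k * avg J phi.
Proof.
move=> fJ iphi; rewrite !avgE//.
  by rewrite RintegralZl ?mulrA//; exact: finite_interval_measurable.
rewrite (_ : _ \o _ = (fun x => k%:E * (EFin \o phi) x)%E).
  by apply: integrableZl => //; exact: finite_interval_measurable.
by apply/funext.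
Qed.

Lemma integrable_scale J phi k : measurable J -> mu.-integrable J (EFin \o phi) ->
  mu.-integrable J (EFin \o (fun x => k * phi x)).
Proof.
move=> mJ iphi; rewrite (_ : _ \o _ = (fun x => k%:E * (EFin \o phi) x)%E).
  exact: integrableZl.
by apply/funext.
Qed.

Lemma bmo_norm_scale (p nu k : R) Q phi : 0 < p -> 0 <= nu -> finite_interval Q ->
  mu.-integrable Q (EFin \o phi) -> (bmo_norm p Q phi <= nu%:E)%E ->
  (bmo_norm p Q (fun x => k * phi x)%R <= (`|k| * nu)%:E)%E.
Proof.
move=> p0 nu0 fQ iphi /(bmo_norm_leP _ _ p0 nu0) h.
apply/bmo_norm_leP => // [|J [fJ JQ]]; first by rewrite mulr_ge0.
have mJ := finite_interval_measurable fJ.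
have iphiJ : mu.-integrable J (EFin \o phi).
  by apply: integrableS iphi => //; exact: finite_interval_measurable.
rewrite avgZ//.
rewrite (_ : (\int[mu]_(x in J) _)%E =
    \int[mu]_(x in J) ((`|k| `^ p)%:E * (`|phi x - avg J phi| `^ p)%:E))%E; last first.
  by apply: eq_integral => x _; rewrite -mulrBr normrM powRM.
rewrite ge0_integralZl_EFin ?powR_ge0//; last first.
  by apply: measurable_powR_osc; exact: integrable_measurable.
rewrite powRM// -mulrA [leRHS]EFinM lee_wpmul2l ?lee_fin ?powR_ge0//.
by apply: h.
Qed.

(** The John-Nirenberg property applies to k psi with psi = phi - f. Going back to phi costs a
    factor e^(|k| M) in the integral of the exponential and another in the exponential of the
    average, M being an essential bound of |f|. Negative k serve for - phi. *)
Lemma Ainfty_exp (p e0 nu k : R) Q phi f : 0 < p -> JN_property p e0 ->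
  finite_interval Q -> mu.-integrable Q (EFin \o phi) -> Linfty Q f ->
  0 <= nu -> (bmo_norm p Q (phi \- f)%R <= nu%:E)%E -> `|k| * nu < e0 ->
  Ainfty Q (fun x => expR (k * phi x)).
Proof.
move=> p0 JN fQ iphi /[dup] Lf + nu0 hnu ke0.
have mQ := finite_interval_measurable fQ.
move=> /(Linfty_bounded mQ)[mf [M0 hM0]].
pose M := Num.max 0 M0; have M_ge0 : 0 <= M by rewrite le_max lexx.
have hM : {ae mu, forall x, Q x -> `|f x| <= M}.
  case: hM0 => N [mN N0 sN]; exists N; split => //; apply: subset_trans sN => x /= nh h.
  by apply: nh => Qx; rewrite le_max h ?orbT.
have if_ : mu.-integrable Q (EFin \o f).
  apply/integrableP; split; first exact/measurable_EFinP.
  apply: (@le_lt_trans _ _ (\int[mu]_(x in Q) (cst M%:E x))%E).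
    apply: ae_ge0_le_integral => //.
    by apply: measurableT_comp => //; exact/measurable_EFinP.
  rewrite integral_cst// lte_mul_pinfty ?lee_fin//.
  by have [_ /andP[]] := fQ.
pose psi := (phi \- f)%R.
have ipsi : mu.-integrable Q (EFin \o psi).
  rewrite (_ : EFin \o psi = (EFin \o phi) \- (EFin \o f))%E; last by apply/funext.
  exact: integrableB.
have kpsi : (bmo_norm p Q (fun x => k * psi x)%R <= (`|k| * nu)%:E)%E.
  by exact: bmo_norm_scale.
have ke : 0 <= `|k| * nu < e0 by rewrite mulr_ge0.
have [C C0 HC] := JN _ ke.
have BMOk : BMO p Q (fun x => k * psi x).
  by split; [exact: integrable_scale|apply: le_lt_trans kpsi _; exact: ltry].
have {}HC := HC _ _ fQ BMOk kpsi.
have subI J : subinterval Q J -> [/\ finite_interval J, measurable J & J `<=` Q] /\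
    [/\ mu.-integrable J (EFin \o phi), mu.-integrable J (EFin \o f) &
        mu.-integrable J (EFin \o psi)].
  move=> [fJ JQ]; have mJ := finite_interval_measurable fJ.
  split; split => //; [exact: integrableS iphi|exact: integrableS if_|].
  exact: integrableS ipsi.
have mphi : measurable_fun Q phi by exact: integrable_measurable.
have mexp : measurable_fun Q (fun x => expR (k * phi x)).
  by apply: measurableT_comp => //; exact: measurable_funM.
have expb J : subinterval Q J ->
    (\int[mu]_(x in J) (expR (k * phi x))%:E <=
     (expR (`|k| * M) * (C * expR (avg J (fun x => k * psi x)) * len J))%:E)%E.
  move=> QJ; have [[fJ mJ JQ] [iphiJ ifJ ipsiJ]] := subI _ QJ.
  have := HC J QJ; rewrite eavg_le// => h.
  have mexpsi : measurable_fun J (fun x => expR (k * psi x)).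
    apply: measurableT_comp => //; apply: measurable_funM => //.
    exact: integrable_measurable.
  apply: (@le_trans _ _ (\int[mu]_(x in J)
      ((expR (`|k| * M))%:E * (expR (k * psi x))%:E))%E).
    apply: ae_ge0_le_integral => //.
    - by apply/measurable_EFinP; exact: measurable_funS mexp.
    - apply: emeasurable_funM => //; exact/measurable_EFinP.
    - case: hM => N [mN N0 sN]; exists N; split => //.
      apply: subset_trans sN => x /= nh H.
      apply: nh => Jx; rewrite -EFinM lee_fin -expRD ler_expR /psi/=.
      have := ler_norm (k * f x); rewrite normrM => h1.
      have h2 : `|k| * `|f x| <= `|k| * M by apply: ler_wpM2l => //; apply: H; exact: JQ.
      by rewrite mulrBr; lra.
  rewrite ge0_integralZl_EFin ?expR_ge0//; last exact/measurable_EFinP.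
  by rewrite [leRHS]EFinM lee_wpmul2l ?lee_fin ?expR_ge0.
have avgb J : subinterval Q J -> avg J (fun x => k * psi x) <= k * avg J phi + `|k| * M.
  move=> QJ; have [[fJ mJ JQ] [iphiJ ifJ ipsiJ]] := subI _ QJ.
  have L0 := len_gt0 fJ.
  have -> : avg J (fun x => k * psi x) =
      k * avg J phi - k * ((\int[mu]_(x in J) f x) / len J).
    rewrite avgZ// -mulrBr; congr (_ * _); rewrite !avgE// -mulrBl; congr (_ / _).
    by rewrite -RintegralB.
  rewrite lerD2l -mulrN; apply: (le_trans (ler_norm _)).
  rewrite normrM normrN ler_wpM2l//.
  rewrite normrM [X in _ * X]gtr0_norm ?invr_gt0// ler_pdivrMr//.
  apply: (le_trans (le_normr_Rintegral _ _)) => //.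
  rewrite -lee_fin -EFin_Rintegral//; last first.
    by rewrite (_ : _ \o _ = abse \o (EFin \o f)); [exact: integrable_abse|apply/funext].
  apply: (@le_trans _ _ (\int[mu]_(x in J) (cst M%:E x))%E).
    apply: ae_ge0_le_integral => //.
    - apply/measurable_EFinP; apply: measurableT_comp => //; exact: integrable_measurable.
    - case: hM => N [mN N0 sN]; exists N; split => //.
      apply: subset_trans sN => x /= nh H.
      by apply: nh => Jx; rewrite lee_fin; apply: H; exact: JQ.
  by rewrite integral_cst// [X in (_ * X)%E](finite_interval_len fJ).
have QQ : subinterval Q Q by split.
split.
- by apply: aeW => x _; exact: expR_gt0.
- apply/integrableP; split; first exact/measurable_EFinP.
  rewrite (_ : (\int[mu]_(x in Q) _)%E = \int[mu]_(x in Q) (expR (k * phi x))%:E)%E.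
    by apply: le_lt_trans (expb _ QQ) _; exact: ltry.
  by apply: eq_integral => x _; rewrite /= ger0_norm ?expR_ge0.
- rewrite (_ : EFin \o _ = EFin \o (fun x => k * phi x)); first exact: integrable_scale.
  by apply/funext => x /=; rewrite expRK.
- apply: (@le_lt_trans _ _ (expR (`|k| * M) * C * expR (`|k| * M))%:E); last exact: ltry.
  apply: ge_ereal_sup => _ [J QJ <-].
  have [[fJ mJ JQ] [iphiJ ifJ ipsiJ]] := subI _ QJ.
  have -> : (@ln R) \o (fun x => expR (k * phi x)) = (fun x => k * phi x).
    by apply/funext => x /=; rewrite expRK.
  rewrite avgZ//.
  apply: (@le_trans _ _ ((expR (`|k| * M) * (C * expR (avg J (fun x => k * psi x))))%:E *
      (expR (- (k * avg J phi)))%:E)%E).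
    rewrite lee_wpmul2r ?lee_fin ?expR_ge0// eavg_le//.
    by have := expb _ QJ; rewrite mulrA.
  rewrite -EFinM lee_fin -!mulrA ler_wpM2l ?expR_ge0// ler_wpM2l ?(ltW C0)//.
  by rewrite -expRD ler_expR lerBlDl; exact: avgb.
Qed.

End perturbation.

(** * The two halves of the theorem *)

Section sharpness.
Context {R : realType}.
Notation mu := (@lebesgue_measure R).
Implicit Types (J Q : set R) (phi f : R -> R).

(** The number 0 has the property vacuously. *)
Lemma JN_const_ge0 (p : R) : (0 <= JN_const p)%E.
Proof.
apply: ereal_sup_ubound; exists 0 => // e /andP[e0 /(le_lt_trans e0)].
by rewrite ltxx.
Qed.

(** The exponent 0 gives the constant weight 1. *)
Lemma Ainfty_index_ge0 Q phi : finite_interval Q -> (0 <= Ainfty_index Q phi)%E.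
Proof.
move=> fQ; have mQ := finite_interval_measurable fQ.
have Qoo : (mu Q < +oo)%E by have [_ /andP[]] := fQ.
apply: ereal_sup_ubound; exists 0 => //=.
have -> : (fun x => expR (0 * phi x)) = cst 1.
  by apply/funext => x; rewrite mul0r expR0.
have lnc : (@ln R) \o @cst R R 1 = @cst R R 0 by apply/funext => x /=; rewrite ln1.
split.
- by apply: aeW => x _ /=.
- exact: integrable_cst_lty.
- by rewrite lnc; exact: integrable_cst_lty.
- apply: (@le_lt_trans _ _ 1%:E); last exact: ltry.
  apply: ge_ereal_sup => _ [J [fJ JQ] <-].
  have mJ := finite_interval_measurable fJ.
  have Joo : (mu J < +oo)%E by have [_ /andP[]] := fJ.
  rewrite lnc avgE//; last exact: integrable_cst_lty.
  rewrite Rintegral_cst// mul0r mul0r oppr0 expR0 mule1 eavg_le// mul1r.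
  rewrite (_ : (\int[mu]_(x in J) _)%E = \int[mu]_(x in J) (cst 1%E x))%E//.
  by rewrite integral_cst// mul1e [X in (X <= _)%E](finite_interval_len fJ).
Qed.

Lemma le_Ainfty_index (p e0 nu e : R) Q phi f : 0 < p -> JN_property p e0 ->
  finite_interval Q -> mu.-integrable Q (EFin \o phi) -> Linfty Q f ->
  0 <= nu -> (bmo_norm p Q (phi \- f)%R <= nu%:E)%E -> 0 <= e -> e * nu < e0 ->
  (e%:E <= Order.min (Ainfty_index Q phi) (Ainfty_index Q (\- phi)%R))%E.
Proof.
move=> p0 JN fQ iphi Lf nu0 hnu e_ge0 ee0; rewrite le_min; apply/andP; split.
  apply: ereal_sup_ubound; exists e => //=.
  by apply: (Ainfty_exp p0 JN fQ iphi Lf nu0 hnu); rewrite ger0_norm.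
apply: ereal_sup_ubound; exists e => //=.
have -> : (fun x => expR (e * (\- phi)%R x)) = (fun x => expR (- e * phi x)).
  by apply/funext => x; rewrite mulrN mulNr.
by apply: (Ainfty_exp p0 JN fQ iphi Lf nu0 hnu); rewrite normrN ger0_norm.
Qed.

Lemma JN_bound_le_dist (p : R) Q phi : 0 < p -> finite_interval Q -> BMO p Q phi ->
  (JN_bound (JN_const p) Q phi <= bmo_dist p Q phi)%E.
Proof.
move=> p0 fQ [iphi _]; apply: le_ereal_inf_tmp => _ [f Lf <-].
rewrite /JN_bound; set r := Order.min _ _.
have r0 : (0 <= r)%E by rewrite le_min; apply/andP; split; exact: Ainfty_index_ge0.
have N0 := bmo_norm_ge0 p (phi \- f)%R fQ.
have [Noo|Nlt] := eqVneq (bmo_norm p Q (phi \- f)%R) +oo%E; first by rewrite Noo leey.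
have [nu nuE] : exists nu, bmo_norm p Q (phi \- f)%R = nu%:E.
  exists (fine (bmo_norm p Q (phi \- f)%R)).
  by rewrite fineK// ge0_fin_numE// ltey.
have nu0 : 0 <= nu by rewrite -lee_fin -nuE.
have hnu : (bmo_norm p Q (phi \- f)%R <= nu%:E)%E by rewrite nuE.
rewrite nuE; clear N0 Nlt nuE.
have key s : r = s%:E -> (JN_const p <= (nu * s)%:E)%E.
  move=> rs; have s0 : 0 <= s by rewrite -lee_fin -rs.
  apply: ge_ereal_sup => _ [e0 JN <-]; rewrite lee_fin leNgt; apply/negP => h.
  (* This d > 0 satisfies (s + d) nu < e0, because d nu < d (nu + 1) = e0 - nu s; the exponent s + d
     is thus admissible, although r = s. Dividing by nu + 1 covers nu = 0. *)
  pose d := (e0 - nu * s) / (nu + 1).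
  have nu1 : 0 < nu + 1 by rewrite ltr_wpDl.
  have d0 : 0 < d by rewrite divr_gt0// subr_gt0.
  have dE : d * (nu + 1) = e0 - nu * s by rewrite divfK// gt_eqF.
  have : ((s + d)%:E <= r)%E.
    apply: (le_Ainfty_index p0 JN fQ iphi Lf nu0 hnu).
      by rewrite addr_ge0// ltW.
    by rewrite mulrDl; nra.
  by rewrite rs lee_fin gerDl leNgt d0.
case: (r) r0 key => [s| |] //; last by move=> _ _; rewrite invey mule0.
rewrite lee_fin => s_ge0 /(_ _ erefl) h.
move: s_ge0 h; rewrite [0 <= s]le_eqVlt => /predU1P[<-|s0] h.
  rewrite mulr0 in h.
  (* For s = 0 the inverse is [+oo], and the product is 0 only because the constant vanishes. *)
  have -> : JN_const p = 0%E by apply/eqP; rewrite eq_le h JN_const_ge0.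
  by rewrite mul0e.
by rewrite inver gt_eqF// lee_pdivrMr.
Qed.

Lemma finite_interval01 : finite_interval (`]0%R, 1%R[%classic : set R).
Proof. exact: finite_interval_ooitv. Qed.

(** Up to its null endpoints, every subinterval is some ]a, b] with 0 <= a < b <= 1, where [log_osc]
    applies. *)
Lemma bmo_norm_log (p c : R) : 1 < p -> 0 <= c ->
  (forall rho I, 0 < rho < 1 -> - ln rho * geo_osc p rho I `^ p^-1 <= c) ->
  (bmo_norm p `]0%R, 1%R[ (fun x => - ln x)%R <= c%:E)%E.
Proof.
move=> p1 c0 hc; apply/bmo_norm_leP => //; first exact: lt_trans p1.
move=> J [fJ J01]; have [a [b [b0 [b1 [ab JE]]]]] := finite_interval_itv fJ.
have sJ : `]a, b[ `<=` J.
  by rewrite JE => x /=; rewrite !in_itv/= => /andP[ax xb]; rewrite !lteifS.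
have sab : `]a, b[ `<=` `]0%R, 1%R[ by exact: subset_trans J01.
have a0 : 0 <= a.
  rewrite leNgt; apply/negP => a0.
  have : `]a, b[%classic (a + (Num.min b 0 - a) / 2).
    by rewrite /= in_itv/=; case: (ltP b 0) => ?; lra.
  by move=> /sab/=; rewrite in_itv/=; case: (ltP b 0) => ?; lra.
have leb1 : b <= 1.
  rewrite leNgt; apply/negP => leb1.
  have : `]a, b[%classic (b - (b - Num.max a 1) / 2).
    by rewrite /= in_itv/=; case: (ltP a 1) => ?; lra.
  by move=> /sab/=; rewrite in_itv/=; case: (ltP a 1) => ?; lra.
have mln : measurable_fun `]a, b[ (fun x => - ln x : R).
  by apply: measurable_funTS; apply: measurableT_comp.
have lenJ : len J = b - a by rewrite /len JE fine_mu_itv// ltW.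
have iJ : mu.-integrable J (EFin \o (fun x => - ln x)).
  have i01 := integrable_log (lexx (0 : R)) ltr01 (lexx (1 : R)).
  apply: integrableS i01 => //; first exact: finite_interval_measurable.
  apply: subset_trans J01 _ => x /=; rewrite !in_itv/= => /andP[-> /ltW//].
have intE : \int[mu]_(x in J) (- ln x) = \int[mu]_(x in `]a, b]) (- ln x).
  rewrite /Rintegral JE integral_itv_bndoo; last exact/measurable_EFinP.
  by rewrite [in RHS]integral_itv_bndoo//; exact/measurable_EFinP.
rewrite avgE// lenJ intE.
have mosc m : measurable_fun `]a, b[ (fun x => (`|- ln x - m| `^ p)%:E).
  exact: measurable_powR_osc.
have := log_osc a0 ab leb1 p1 c0 hc.
rewrite (@integral_itv_bndoo _ a b _ false false); last exact: mosc.
by move=> h; rewrite JE integral_itv_bndoo; [exact: h|exact: mosc].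
Qed.

(** On the dyadic piece ]2^(-i-1), 2^(-i)] the integrand is at least 1/x, hence at least 2^i, so
    each piece contributes at least 1/2. *)
Lemma integral_exp_log (e : R) : 1 <= e ->
  (\int[mu]_(x in `]0%R, 1%R[) (expR (e * - ln x))%:E = +oo)%E.
Proof.
move=> e1.
have mf : measurable_fun setT (fun x : R => expR (e * - ln x)).
  apply: measurableT_comp => //; apply: measurable_funM => //.
  exact: measurableT_comp.
have -> : (\int[mu]_(x in `]0%R, 1%R[) (expR (e * - ln x))%:E =
           \int[mu]_(x in `]0%R, 1%R]) (expR (e * - ln x))%:E)%E.
  rewrite [RHS]integral_itv_bndoo//.
  by apply/measurable_EFinP; exact: measurable_funTS.
have h01 : 0 < (2^-1 : R) < 1 by lra.
apply/eqyP => A A0; pose n := Num.bound (2 * A).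
rewrite (integral_nodes n ltr01 h01)//.
apply: (@le_trans _ _ (\sum_(i < n) (2^-1 : R)%:E)%E).
  rewrite sumEFin lee_fin sumr_const card_ord -mulr_natr.
  have : 2 * A < n%:R by apply: archi_boundP; rewrite mulr_ge0// ltW.
  lra.
rewrite -[leLHS]adde0 leeD//; last first.
  by apply: integral_ge0 => x _; rewrite lee_fin expR_ge0.
apply: lee_sum => i _.
have ni := node_gt0 (lexx (0 : R)) ltr01 h01.
apply: (@le_trans _ _ (\int[mu]_(x in `]node 0 1 2^-1 i.+1, node 0 1 2^-1 i])
    (cst ((node 0 1 2^-1 i)^-1)%:E x))%E).
  rewrite integral_cst//= lebesgue_measure_itv/= lte_fin node_lt// -EFinD -EFinM lee_fin.
  rewrite ler_pdivlMl// /node exprS; lra.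
apply: ge0_le_integral => //.
- by move=> x _; rewrite lee_fin invr_ge0 ltW.
- by apply/measurable_EFinP; exact: measurable_funTS.
- move=> x /=; rewrite in_itv/= => /andP[x1 x2]; rewrite lee_fin.
  have x0 : 0 < x by exact: lt_trans (ni _) x1.
  have lnx : 0 <= - ln x.
    by rewrite oppr_ge0 ln_le0// (le_trans x2)// -[leRHS](node0 0 1 2^-1) node_le.
  apply: (@le_trans _ _ (expR (- ln x))).
    by rewrite expRN lnK ?posrE// lef_pV2 ?posrE.
  by rewrite ler_expR ler_peMl.
Qed.

Lemma Ainfty_index_log : (Ainfty_index `]0%R, 1%R[ (fun x : R => - ln x)%R <= 1)%E.
Proof.
apply: ge_ereal_sup => _ [e /= [_ /integrableP[_ iexp] _ _] <-].
rewrite lee_fin leNgt; apply/negP => e1; move: iexp.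
rewrite (_ : (\int[mu]_(x in _) _)%E =
    \int[mu]_(x in `]0%R, 1%R[) (expR (e * - ln x))%:E)%E.
  by rewrite integral_exp_log ?ltxx// ltW.
by apply: eq_integral => x _; rewrite /= ger0_norm ?expR_ge0.
Qed.

(** For - ln on ]0, 1[ the distance to bounded functions is at most its norm, hence at most the
    John-Nirenberg constant, whereas the index is at most 1 and makes the proposed bound at least
    c. *)
Lemma JN_bound_sharp (p c : R) : 1 < p -> (JN_const p < c%:E)%E ->
  ~ (forall Q phi, finite_interval Q -> BMO p Q phi ->
       (JN_bound c%:E Q phi <= bmo_dist p Q phi)%E).
Proof.
move=> p1 pc H.
have [e eE] : exists e, JN_const p = e%:E.
  exists (fine (JN_const p)); rewrite fineK// ge0_fin_numE ?JN_const_ge0//.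
  exact: lt_trans pc (ltry c).
have e0 : 0 <= e by rewrite -lee_fin -eE JN_const_ge0.
have ec : e < c by rewrite -lte_fin -eE.
(* Each of these numbers has the John-Nirenberg property, so it is at most the supremum e. *)
have hgeo rho I : 0 < rho < 1 -> - ln rho * geo_osc p rho I `^ p^-1 <= e.
  move=> rho01; rewrite -lee_fin -eE; apply: ereal_sup_ubound.
  by exists (- ln rho * geo_osc p rho I `^ p^-1) => //; exact: JN_property_geo.
pose phi := fun x : R => - ln x.
have norm_phi := bmo_norm_log p1 e0 hgeo.
have BMOphi : BMO p `]0%R, 1%R[ phi.
  split; last by apply: le_lt_trans norm_phi _; exact: ltry.
  have i01 := integrable_log (lexx (0 : R)) ltr01 (lexx (1 : R)).
  apply: integrableS i01 => // x /=; rewrite !in_itv/= => /andP[-> /ltW//].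
have := H _ _ finite_interval01 BMOphi.
rewrite leNgt => /negP; apply.
apply: (@le_lt_trans _ _ e%:E).
  apply: le_trans norm_phi; apply: ereal_inf_lbound; exists (cst 0).
    exact: Linfty_cst0.
  by congr bmo_norm; apply/funext => x /=; rewrite subr0.
apply: (@lt_le_trans _ _ c%:E); first by rewrite lte_fin.
rewrite /JN_bound; set r := Order.min _ _.
have r0 : (0 <= r)%E.
  by rewrite le_min; apply/andP; split; exact: (Ainfty_index_ge0 _ finite_interval01).
have r1 : (r <= 1)%E.
  by rewrite ge_min; apply/orP; left; exact: Ainfty_index_log.
have c0 : 0 < c by exact: le_lt_trans ec.
clearbody r; case: r r0 r1 => [s s_ge0 s1| _ |]; last 2 first.
- by rewrite leye_eq.
- by rewrite leeNy_eq.
rewrite lee_fin in s1.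
move: s_ge0; rewrite lee_fin; rewrite [0 <= s]le_eqVlt => /predU1P[<-|s0].
  by rewrite inve0 gt0_muley ?leey// lte_fin.
by rewrite inver gt_eqF// -EFinM lee_fin ler_peMr ?(ltW c0)// invf_ge1.
Qed.

End sharpness.

Local Open Scope ereal_scope.

Theorem theorem1p3 (R : realType) (p : R) (p_gt2 : (2 < p)%R) :
  (forall (Q : set R) (phi : R -> R), finite_interval Q -> BMO p Q phi ->
     JN_bound (JN_const p) Q phi <= bmo_dist p Q phi) /\
  (forall c : R, JN_const p < c%:E ->
     ~ (forall (Q : set R) (phi : R -> R), finite_interval Q -> BMO p Q phi ->
          JN_bound c%:E Q phi <= bmo_dist p Q phi)).
Proof.
have p1 : (1 < p)%R by apply: lt_trans p_gt2; rewrite ltr1n.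
split=> [Q phi|c]; last exact: JN_bound_sharp.
exact/JN_bound_le_dist/(lt_trans ltr01).
Qed.
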